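(* Let $\mathsf K_{\mathfrak g}$ be the kernel of the action of $\mathsf{Cact}_W$ on $\mathscr O^{int}_q(\mathfrak g)$ given by $\tau_J\mapsto\sigma^J_\bullet$, $J\in\mathscr J$. Then the assignments $\sigma^J\mapsto w_\circ^J$, $J\in\mathscr J$ (where $\sigma^J$ denotes the image of $\tau_J$ in $\mathsf{Cact}_W/\mathsf K_{\mathfrak g}$), define a surjective homomorphism $\mathsf{Cact}_W/\mathsf K_{\mathfrak g}\to W$ which refines the natural epimorphism $\mathsf{Cact}_W\to W$, $\tau_J\mapsto w_\circ^J$ (that is, the latter is the composition of the quotient map $\mathsf{Cact}_W\to\mathsf{Cact}_W/\mathsf K_{\mathfrak g}$ with the former).
   Context: Root data. $I$ is a finite set, $A=(a_{ij})_{i,j\in I}$ a symmetrizable generalized Cartan matrix, $\mathfrak h$ a finite-dimensional complex vector space, $\{\alpha_i\}_{i\in I}\subset\mathfrak h^*$, $\{\alpha_i^\vee\}_{i\in I}\subset\mathfrak h$ linearly independent subsets, $(\cdot,\cdot)$ a symmetric non-degenerate bilinear form on $\mathfrak h^*$, $P\subset\mathfrak h^*$ a lattice of rank $\dim\mathfrak h^*$, such that $\alpha_j(\alpha_i^\vee)=a_{ij}$, $(\alpha_i,\alpha_i)\in 2\mathbb Z_{>0}$, $\lambda(\alpha_i^\vee)=2(\lambda,\alpha_i)/(\alpha_i,\alpha_i)$ for $\lambda\in\mathfrak h^*$, $\alpha_i\in P$, $\lambda(\alpha_i^\vee)\in\mathbb Z$ for $\lambda\in P$, and $(P,P)\subset\frac1d\mathbb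 Z$ for some $d\in\mathbb Z_{>0}$. The $\omega_i\in\mathfrak h^*$ defined by $\omega_i(\alpha_j^\vee)=\delta_{ij}$ and $\omega_i(h)=0$ for $h\in\bigcap_{j}\ker\alpha_j$ are assumed to lie in $P$. $Q^+=\sum_i\mathbb Z_{\ge0}\alpha_i$. $\mathfrak g$ is the Kac-Moody algebra attached to these data. The Weyl group $W$ is generated by $s_i$, $s_i\lambda=\lambda-\lambda(\alpha_i^\vee)\alpha_i$ on $\mathfrak h^*$ and $s_ih=h-\alpha_i(h)\alpha_i^\vee$ on $\mathfrak h$. Quantum group. $\Bbbk$ is a field of characteristic zero containing an element $q^{1/(2d)}$ transcendental over $\mathbb Q$; $q_i=q^{(\alpha_i,\alpha_i)/2}$; $(n)_v=\frac{v^n-v^{-n}}{v-v^{-1}}$, $(n)_v!=\prod_{s=1}^n(s)_v$, $X_i^{(n)}=X_i^n/(n)_{q_i}!$. $U_q(\mathfrak g)$ is the $\Bbbk$-algebra generated by $E_i,F_i$ ($i\in I$), $K_\lambda$ ($\lambda\in\frac12P$, $K_\lambda K_\mu=K_{\lambda+\mu}$, $K_0=1$) with relations $K_\lambda E_i=q^{(\lambda,\alpha_i)}E_iK_\lambda$, $K_\lambda F_i=q^{-(\lambda,\alpha_i)}F_iK_\lambda$, $[E_i,F_j]=\delta_{ij}\frac{K_{\alpha_i}-K_{-\alpha_i}}{q_i-q_i^{-1}}$ and the quantum Serre relations $\sum_{r+s=1-a_{ij}}(-1)^rE_i^{(r)}E_jE_i^{(s)}=0=\sum_{r+s=1-a_{ij}}(-1)^rF_i^{(r)}F_jF_i^{(s)}$,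 $i\ne j$. $U_q^{+}(\mathfrak g)$ is the subalgebra generated by the $E_i$, graded by $Q^+$ with $\deg E_i=\alpha_i$. Category. $\mathscr O^{int}_q(\mathfrak g)$ is the full subcategory of $U_q(\mathfrak g)$-modules $M$ such that $M=\bigoplus_{\beta\in P}M(\beta)$, $M(\beta)=\{m:K_\lambda(m)=q^{(\lambda,\beta)}m\ \forall\lambda\in\frac12P\}$, all $E_i,F_i$ act locally nilpotently, and for each $m\in M$ there is $N(m)\ge0$ with $U_q^+(\mathfrak g)(\nu)(m)=0$ for every $\nu=\sum n_i\alpha_i\in Q^+$ with $\sum n_i\ge N(m)$. Operators $\sigma^J$. $\mathscr J$ is the set of non-empty $J\subset I$ for which $W_J=\langle s_j:j\in J\rangle$ is finite; $w_\circ^J$ is the longest element of $W_J$; for $j\in J$, $j^\star\in J$ is determined by $s_{j^\star}=w_\circ^Js_jw_\circ^J$. For $w\in W_J$ with a reduced expression $w=s_{i_1}\cdots s_{i_m}$ and $\lambda\in P$ with $\lambda(\alpha_j^\vee)\ge0$ for all $j\in J$ put $F_{w,\lambda}=F_{i_1}^{(a_1)}\cdots F_{i_m}^{(a_m)}$, $a_k=\lambda(s_{i_m}\cdots s_{i_{k+1}}\alpha_{i_k}^\vee)$ (independent of the reduced expression). For $v\in\bigcap_{j\in J}\ker E_j$ with weight components $v(\lambda)\in V(\lambda)$ put $v^J=\sum_\lambda F_{w_\circ^J,\lambda}(v(\lambda))$. For $V\in\mathscr O^{int}_q(\mathfrak g)$, $\sigma^J_V$ is the unique $\Bbbk$-linear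 map $V\to V$ with $\sigma^J_V(v)=v^J$ for $v\in\bigcap_{j\in J}\ker E_j$ and $\sigma^J_V(F_j(v))=E_{j^\star}(\sigma^J_V(v))$, $\sigma^J_V(E_j(v))=F_{j^\star}(\sigma^J_V(v))$ for $j\in J$, $v\in V$. Cactus group. $\mathsf{Cact}_W$ is the group generated by $\tau_J$, $J\in\mathscr J$, subject to: $\tau_J^2=1$; $\tau_J=\tau_{J'}\tau_{J''}$ whenever $J=J'\cup J''$ with $J',J''$ orthogonal (i.e. $J'\cap J''=\emptyset$ and $s_{j'}s_{j''}=s_{j''}s_{j'}$ for all $j'\in J'$, $j''\in J''$; in particular $\tau_{J'}\tau_{J''}=\tau_{J''}\tau_{J'}$); and $\tau_J\tau_K=\tau_{K^\star}\tau_J$ for $K\subset J$. For every $V\in\mathscr O^{int}_q(\mathfrak g)$ the assignments $\tau_J\mapsto\sigma^J_V$ define a representation of $\mathsf{Cact}_W$ on $V$; $\mathsf K_{\mathfrak g}$ is the intersection of the kernels of these representations over all $V\in\mathscr O^{int}_q(\mathfrak g)$. *)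

(* Defs.v *)
From HB Require Import structures.
From mathcomp Require Import all_boot all_order all_algebra.
From mathcomp Require Import complex.
From mathcomp Require Import boolp classical_sets cardinality reals.
Set Implicit Arguments.
Unset Strict Implicit.
Unset Printing Implicit Defensive.
Import GRing.Theory Num.Theory.
Local Open Scope ring_scope.

Section GeneratedSubgroup.
Variables (G : groupType) (S : set G).

Inductive generated : G -> Prop :=
| gen_one : generated 1%g
| gen_mem x : S x -> generated x
| gen_mul x y : generated x -> generated y -> generated (x * y)%g
| gen_inv x : generated x -> generated (x^-1)%g.

Definition generatedb : {pred G} := fun x => `[< generated x >].

Lemma generatedb_closed : group_closed generatedb.
Proof.
split; first exact/asboolP/gen_one.
move=> x y /asboolP gx /asboolP gy.
by apply/asboolP; apply: gen_mul => //; apply: gen_inv.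
Qed.

Definition generated_group := {x : G | generatedb x}.
HB.instance Definition _ := Choice.on generated_group.
HB.instance Definition _ := [isSub of generated_group for (@sval G _)].
HB.instance Definition _ :=
  SubChoice_isSubGroup.Build G generatedb generated_group generatedb_closed.

End GeneratedSubgroup.

(* [quotient_group S] is the quotient of [G] by the normal closure of [S]; it is
   the usual G / S when S is a normal subgroup.                               *)
Section QuotientGroup.
Variables (G : groupType) (S : set G).

Definition conjugates : set G := [set y | exists2 x, S x & exists g, y = (x ^ g)%g].

Definition normal_closure : set G := generated conjugates.

Lemma normal_closureJ x g : normal_closure x -> normal_closure (x ^ g)%g.
Proof.
elim=> {x} [|x [y Sy [h ->]]|x y _ gx _ gy|x _ gx].
- by rewrite conj1g; apply: gen_one.
- by rewrite -conjgM; apply: gen_mem; exists y => //; exists (h * g)%g.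
- by rewrite conjMg; apply: gen_mul.
- by rewrite conjVg; apply: gen_inv.
Qed.

Definition quotient_rel (x y : G) : bool := `[< normal_closure (x^-1 * y)%g >].

Lemma quotient_rel_refl : reflexive quotient_rel.
Proof. by move=> x; apply/asboolP; rewrite mulVg; apply: gen_one. Qed.

Lemma quotient_rel_sym : symmetric quotient_rel.
Proof.
suff H x y : quotient_rel x y -> quotient_rel y x.
  by move=> x y; apply/idP/idP; apply: H.
by move=> /asboolP /gen_inv; rewrite invgM invgK => h; apply/asboolP.
Qed.

Lemma quotient_rel_trans : transitive quotient_rel.
Proof.
move=> y x z /asboolP h1 /asboolP h2; apply/asboolP.
by have := gen_mul h1 h2; rewrite mulgA mulgK.
Qed.

Canonical quotient_equiv :=
  EquivRel quotient_rel quotient_rel_refl quotient_rel_sym quotient_rel_trans.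

Definition quotient_group := {eq_quot quotient_equiv}%qT.
HB.instance Definition _ := Choice.on quotient_group.
HB.instance Definition _ := EqQuotient.on quotient_group.

Definition quotient_proj (x : G) : quotient_group := (\pi_quotient_group x)%qT.

Lemma quotient_projP x y :
  quotient_proj x = quotient_proj y <-> normal_closure (x^-1 * y)%g.
Proof.
by split=> [/eqmodP /asboolP //|h]; apply/eqmodP/asboolP.
Qed.

Definition quotient_mul (a b : quotient_group) : quotient_group :=
  quotient_proj (repr a * repr b)%g.
Definition quotient_inv (a : quotient_group) : quotient_group :=
  quotient_proj (repr a)^-1%g.

Lemma quotient_reprK a : quotient_proj (repr a) = a.
Proof. exact: reprK. Qed.

Lemma quotient_mulE x y :
  quotient_mul (quotient_proj x) (quotient_proj y) = quotient_proj (x * y)%g.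
Proof.
apply/quotient_projP.
have /quotient_projP hx := quotient_reprK (quotient_proj x).
have /quotient_projP hy := quotient_reprK (quotient_proj y).
set x' := repr _ in hx *; set y' := repr _ in hy *.
have -> : ((x' * y')^-1 * (x * y) = (x'^-1 * x) ^ y' * (y'^-1 * y))%g.
  by rewrite /conjg invgM !mulgA mulgK.
by apply: gen_mul => //; apply: normal_closureJ.
Qed.

Lemma quotient_invE x : quotient_inv (quotient_proj x) = quotient_proj (x^-1)%g.
Proof.
apply/quotient_projP; rewrite invgK.
have /quotient_projP := quotient_reprK (quotient_proj x).
set x' := repr _ => /gen_inv/(normal_closureJ x^-1)%g.
by rewrite /conjg invgM !invgK !mulgA mulgV mul1g.
Qed.

Lemma quotient_mulA : associative quotient_mul.
Proof.
move=> a b c; rewrite -(quotient_reprK a) -(quotient_reprK b) -(quotient_reprK c).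
by rewrite !quotient_mulE mulgA.
Qed.
Lemma quotient_mul1 : left_id (quotient_proj 1%g) quotient_mul.
Proof. by move=> a; rewrite -(quotient_reprK a) quotient_mulE mul1g. Qed.
Lemma quotient_1mul : right_id (quotient_proj 1%g) quotient_mul.
Proof. by move=> a; rewrite -(quotient_reprK a) quotient_mulE mulg1. Qed.
Lemma quotient_mulV : left_inverse (quotient_proj 1%g) quotient_inv quotient_mul.
Proof.
by move=> a; rewrite -(quotient_reprK a) quotient_invE quotient_mulE mulVg.
Qed.
Lemma quotient_Vmul : right_inverse (quotient_proj 1%g) quotient_inv quotient_mul.
Proof.
by move=> a; rewrite -(quotient_reprK a) quotient_invE quotient_mulE mulgV.
Qed.

HB.instance Definition _ := isGroup.Build quotient_group
  quotient_mulA quotient_mul1 quotient_1mul quotient_mulV quotient_Vmul.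

Lemma quotient_projM : {morph quotient_proj : x y / (x * y)%g}.
Proof. by move=> x y; rewrite -quotient_mulE. Qed.
HB.instance Definition _ :=
  isMultiplicative.Build G quotient_group quotient_proj quotient_projM.

End QuotientGroup.

(* [presented_group rel] is the group with generators [X] and a relation u = v
   for every pair of words such that [rel u v]; the letters (x, true) and
   (x, false) stand for x and its inverse.                                    *)
Section PresentedGroup.
Variables (X : choiceType) (rel : seq X -> seq X -> Prop).

Local Notation word := (seq (X * bool)).

Inductive word_eq : word -> word -> Prop :=
| weq_refl u : word_eq u u
| weq_sym u v : word_eq u v -> word_eq v u
| weq_trans v u w : word_eq u v -> word_eq v w -> word_eq u w
| weq_cat u u' v v' : word_eq u u' -> word_eq v v' -> word_eq (u ++ v) (u' ++ v')
| weq_cancel x b : word_eq [:: (x, b); (x, ~~ b)] [::]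
| weq_rel u v : rel u v ->
    word_eq [seq (x, true) | x <- u] [seq (x, true) | x <- v].

Definition word_eqb (u v : word) : bool := `[< word_eq u v >].

Lemma word_eqb_refl : reflexive word_eqb.
Proof. by move=> u; apply/asboolP/weq_refl. Qed.
Lemma word_eqb_sym : symmetric word_eqb.
Proof. by move=> u v; apply/asboolP/asboolP; apply: weq_sym. Qed.
Lemma word_eqb_trans : transitive word_eqb.
Proof.
move=> v u w /asboolP uv /asboolP vw; apply/asboolP; exact: weq_trans uv vw.
Qed.

Canonical word_equiv := EquivRel word_eqb word_eqb_refl word_eqb_sym word_eqb_trans.

Definition presented_group := {eq_quot word_equiv}%qT.
HB.instance Definition _ := Choice.on presented_group.
HB.instance Definition _ := EqQuotient.on presented_group.

Definition word_class (u : word) : presented_group := (\pi_presented_group u)%qT.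

Lemma word_classP u v : word_class u = word_class v <-> word_eq u v.
Proof. by split=> [/eqmodP /asboolP //|h]; apply/eqmodP/asboolP. Qed.

Lemma word_reprK a : word_class (repr a) = a.
Proof. exact: reprK. Qed.

Definition word_inv (u : word) : word := rev [seq (p.1, ~~ p.2) | p <- u].

Lemma word_inv_cat u v : word_inv (u ++ v) = word_inv v ++ word_inv u.
Proof. by rewrite /word_inv map_cat rev_cat. Qed.

Lemma word_invK : involutive word_inv.
Proof.
move=> u; rewrite /word_inv map_rev revK -map_comp map_id_in// => -[x b] _ /=.
by rewrite negbK.
Qed.

Lemma word_mulV u : word_eq (u ++ word_inv u) [::].
Proof.
elim: u => [|[x b] u IH] /=; first exact: weq_refl.
rewrite -[X in _ :: (u ++ X)]/(word_inv ([:: (x, b)] ++ u)) word_inv_cat.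
rewrite -cat1s (catA u) catA.
apply: (@weq_trans ([:: (x, b)] ++ [:: (x, ~~ b)])); last exact: weq_cancel.
apply: weq_cat; last exact: weq_refl.
rewrite -[X in word_eq _ X]cats0.
by apply: weq_cat => //; apply: weq_refl.
Qed.

Lemma word_mulVw u : word_eq (word_inv u ++ u) [::].
Proof. by have := word_mulV (word_inv u); rewrite word_invK. Qed.

Lemma word_eq_inv u v : word_eq u v -> word_eq (word_inv u) (word_inv v).
Proof.
move=> uv.
apply: (@weq_trans (word_inv u ++ (v ++ word_inv v))).
  rewrite -[X in word_eq X _]cats0.
  by apply: weq_cat; [apply: weq_refl|apply: weq_sym; apply: word_mulV].
rewrite catA -[X in word_eq _ X]cat0s.
apply: weq_cat; last exact: weq_refl.
apply: (@weq_trans (word_inv u ++ u)); last exact: word_mulVw.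
by apply: weq_cat; [apply: weq_refl|apply: weq_sym].
Qed.

Definition presented_mul (a b : presented_group) := word_class (repr a ++ repr b).
Definition presented_inv (a : presented_group) := word_class (word_inv (repr a)).

Lemma presented_mulE u v :
  presented_mul (word_class u) (word_class v) = word_class (u ++ v).
Proof.
by apply/word_classP; apply: weq_cat; apply/word_classP; apply: word_reprK.
Qed.

Lemma presented_invE u : presented_inv (word_class u) = word_class (word_inv u).
Proof. by apply/word_classP/word_eq_inv/word_classP/word_reprK. Qed.

Lemma presented_mulA : associative presented_mul.
Proof.
move=> a b c; rewrite -(word_reprK a) -(word_reprK b) -(word_reprK c).
by rewrite !presented_mulE catA.
Qed.
Lemma presented_mul1 : left_id (word_class [::]) presented_mul.
Proof. by move=> a; rewrite -(word_reprK a) presented_mulE. Qed.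
Lemma presented_1mul : right_id (word_class [::]) presented_mul.
Proof. by move=> a; rewrite -(word_reprK a) presented_mulE cats0. Qed.
Lemma presented_mulV : left_inverse (word_class [::]) presented_inv presented_mul.
Proof.
move=> a; rewrite -(word_reprK a) presented_invE presented_mulE.
exact/word_classP/word_mulVw.
Qed.
Lemma presented_Vmul : right_inverse (word_class [::]) presented_inv presented_mul.
Proof.
move=> a; rewrite -(word_reprK a) presented_invE presented_mulE.
exact/word_classP/word_mulV.
Qed.

HB.instance Definition _ := isGroup.Build presented_group
  presented_mulA presented_mul1 presented_1mul presented_mulV presented_Vmul.

Definition presented_gen (x : X) : presented_group := word_class [:: (x, true)].

End PresentedGroup.

Section GeneralLinear.
Variables (K : fieldType) (V : vectType K).

Definition injective_end : {pred 'End(V)} := fun f => lker f == 0%VS.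
Definition linear_group := {f : 'End(V) | injective_end f}.
HB.instance Definition _ := Choice.on linear_group.
HB.instance Definition _ := [isSub of linear_group for (@sval 'End(V) _)].

Lemma lker0_id : lker (\1%VF : 'End(V)) == 0%VS.
Proof. by apply/lker0P => u v; rewrite !lfunE. Qed.
Lemma lker0_comp (f g : linear_group) : lker (val f \o val g)%VF == 0%VS.
Proof.
apply/lker0P => u v; rewrite !comp_lfunE => e.
exact: (lker0P (valP g)) (lker0P (valP f) _ _ e).
Qed.
Lemma lker0_inv (f : linear_group) : lker ((val f)^-1)%VF == 0%VS.
Proof. by apply/lker0P; apply: can_inj (lker0_lfunVK (valP f)). Qed.

Definition linear_one : linear_group := exist injective_end _ lker0_id.
Definition linear_mul f g : linear_group := exist injective_end _ (lker0_comp f g).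
Definition linear_inv f : linear_group := exist injective_end _ (lker0_inv f).

Lemma linear_mulA : associative linear_mul.
Proof. by move=> f g h; apply: val_inj; rewrite /= comp_lfunA. Qed.
Lemma linear_mul1 : left_id linear_one linear_mul.
Proof. by move=> f; apply: val_inj; rewrite /= comp_lfun1l. Qed.
Lemma linear_1mul : right_id linear_one linear_mul.
Proof. by move=> f; apply: val_inj; rewrite /= comp_lfun1r. Qed.
Lemma linear_mulV : left_inverse linear_one linear_inv linear_mul.
Proof. by move=> f; apply: val_inj; rewrite /= lker0_compVf //; exact: (valP f). Qed.
Lemma linear_Vmul : right_inverse linear_one linear_inv linear_mul.
Proof. by move=> f; apply: val_inj; rewrite /= lker0_compfV //; exact: (valP f). Qed.

HB.instance Definition _ := isGroup.Build linear_group
  linear_mulA linear_mul1 linear_1mul linear_mulV linear_Vmul.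

End GeneralLinear.

Definition generalized_cartan (I : finType) (a : I -> I -> int) : Prop :=
  [/\ forall i, a i i = 2,
      forall i j, i != j -> a i j <= 0 &
      forall i j, a i j = 0 -> a j i = 0].

Definition symmetrizable (I : finType) (a : I -> I -> int) : Prop :=
  exists c : I -> int,
    (forall i, 0 < c i) /\ forall i j, c i * a i j = c j * a j i.

(* A lattice of rank dim V: the Z-span of a basis of V. *)
Definition full_lattice (K : fieldType) (V : vectType K) (P : set V) : Prop :=
  exists2 b : (\dim {:V}).-tuple V, basis_of {:V} b &
    forall l, P l <-> exists z : 'I_(\dim {:V}) -> int,
      l = \sum_i tnth b i *~ z i.

(* [rd_omegaP] says that each fundamental weight omega_i, when it exists, lies
   in P; its two defining conditions determine it uniquely if the Cartan matrix
   is nonsingular and are incompatible for some i otherwise.                  *)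
Record root_datum (R : realType) (I : finType) := RootDatum {
  rd_cartan : I -> I -> int;
  rd_h : vectType R[i];
  rd_root : I -> 'Hom(rd_h, R[i]^o);
  rd_coroot : I -> rd_h;
  rd_form : 'Hom(rd_h, R[i]^o) -> 'Hom(rd_h, R[i]^o) -> R[i];
  rd_lattice : set 'Hom(rd_h, R[i]^o);
  rd_d : nat;
  rd_cartanP : generalized_cartan rd_cartan;
  rd_symmetrizable : symmetrizable rd_cartan;
  rd_root_free : free [seq rd_root i | i : I];
  rd_coroot_free : free [seq rd_coroot i | i : I];
  rd_form_scalar : forall m, scalar (rd_form^~ m);
  rd_form_sym : forall l m, rd_form l m = rd_form m l;
  rd_form_nondeg : forall l, (forall m, rd_form l m = 0) -> l = 0;
  rd_latticeP : full_lattice rd_lattice;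
  rd_pairing : forall i j, rd_root j (rd_coroot i) = (rd_cartan i j)%:~R;
  rd_form_even : forall i, exists2 n : nat, (0 < n)%N &
    rd_form (rd_root i) (rd_root i) = (n.*2)%:R;
  rd_corootE : forall (l : 'Hom(rd_h, R[i]^o)) i, l (rd_coroot i) =
    2 * rd_form l (rd_root i) / rd_form (rd_root i) (rd_root i);
  rd_root_lattice : forall i, rd_lattice (rd_root i);
  rd_lattice_int : forall (l : 'Hom(rd_h, R[i]^o)) i, rd_lattice l ->
    exists z : int, l (rd_coroot i) = z%:~R;
  rd_d_gt0 : (0 < rd_d)%N;
  rd_dP : forall l m, rd_lattice l -> rd_lattice m ->
    exists z : int, rd_form l m = z%:~R / rd_d%:R;
  rd_omegaP : forall i (om : 'Hom(rd_h, R[i]^o)),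
    (forall j, om (rd_coroot j) = (i == j)%:R) ->
    (forall x, (forall j, rd_root j x = 0) -> om x = 0) ->
    rd_lattice om
}.

Section WeylGroup.
Variables (R : realType) (I : finType) (D : root_datum R I).

Local Notation h := (rd_h D).
Local Notation h' := 'Hom(h, R[i]^o).
Local Notation alpha := (rd_root D).
Local Notation coroot := (rd_coroot D).

Definition reflection (i : I) (l : h') : h' := l - l (coroot i) *: alpha i.

Definition coreflection (i : I) (x : h) : h := x - alpha i x *: coroot i.

Lemma reflection_is_linear i : linear (reflection i).
Proof.
move=> a l m; rewrite /reflection add_lfunE scale_lfunE scalerDl scalerBr.
by rewrite scalerA opprD addrACA.
Qed.
HB.instance Definition _ i :=
  GRing.isLinear.Build R[i] h' h' _ (reflection i) (reflection_is_linear i).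

Lemma reflectionK i : involutive (reflection i).
Proof.
move=> l; have aii : alpha i (coroot i) = 2%:R.
  by rewrite rd_pairing; have [-> _ _] := rd_cartanP D.
rewrite /reflection add_lfunE opp_lfunE scale_lfunE aii.
have -> : l (coroot i) - l (coroot i) *: 2%:R = - l (coroot i).
  by rewrite [_ *: _]mulr_natr mulr2n opprD addrA subrr sub0r.
by rewrite scaleNr opprK subrK.
Qed.

Lemma lker_reflection i : lker (linfun (reflection i)) == 0%VS.
Proof.
by apply/lker0P => l m; rewrite !lfunE /= => /(can_inj (reflectionK i)).
Qed.

Definition linear_reflection i : linear_group 'Hom(h, R[i]^o) :=
  exist (@injective_end _ _) (linfun (reflection i)) (lker_reflection i).

Definition weyl : Type := generated_group (range linear_reflection).
HB.instance Definition _ := Group.on weyl.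

Lemma linear_reflection_gen i :
  generatedb (range linear_reflection) (linear_reflection i).
Proof. by apply/asboolP/gen_mem; exists i. Qed.

Definition simple_reflection i : weyl :=
  exist (generatedb (range linear_reflection)) _ (linear_reflection_gen i).

Local Notation s := simple_reflection.

Definition parabolic (J : {set I}) : set weyl := generated (s @` [set` J]).

Definition word_prod (w : seq I) : weyl := (\prod_(i <- w) s i)%g.

Definition reduced_word (J : {set I}) (w : seq I) : Prop :=
  all [in J] w /\
  forall u, all [in J] u -> word_prod u = word_prod w -> (size w <= size u)%N.

Definition is_longest (J : {set I}) (x : weyl) : Prop :=
  exists w, [/\ reduced_word J w, word_prod w = x &
    forall u, reduced_word J u -> (size u <= size w)%N].

Definition longest (J : {set I}) : weyl := xget 1%g (is_longest J).

Definition star (J : {set I}) (j : I) : I :=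
  xget j [set j' | j' \in J /\ s j' = (longest J * s j * longest J)%g].

Definition finite_type (J : {set I}) : bool :=
  (0 < #|J|)%N && `[< finite_set (parabolic J) >].

Definition finite_subset : Type := {J : {set I} | finite_type J}.
HB.instance Definition _ := Choice.on finite_subset.
HB.instance Definition _ := [isSub of finite_subset for (@sval {set I} _)].

Definition orthogonal (J J' : {set I}) : Prop :=
  [disjoint J & J'] /\
  forall j j', j \in J -> j' \in J' -> (s j * s j' = s j' * s j)%g.

Inductive cactus_rel : seq finite_subset -> seq finite_subset -> Prop :=
| cactus_involution (J : finite_subset) : cactus_rel [:: J; J] [::]
| cactus_orthogonal (J J' J'' : finite_subset) :
    val J = val J' :|: val J'' -> orthogonal (val J') (val J'') ->
    cactus_rel [:: J] [:: J'; J'']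
| cactus_star (J K K' : finite_subset) :
    val K \subset val J -> val K' = star (val J) @: val K ->
    cactus_rel [:: J; K] [:: K'; J].

Definition cactus : Type := presented_group cactus_rel.
HB.instance Definition _ := Group.on cactus.

Definition tau (J : finite_subset) : cactus := presented_gen cactus_rel J.

End WeylGroup.

Section QuantumIntegers.
Variable k : fieldType.

Definition qint (v : k) (n : nat) : k := (v ^+ n - v ^- n) / (v - v^-1).

Definition qfact (v : k) (n : nat) : k := \prod_(1 <= m < n.+1) qint v m.

Definition divided_power (V : lmodType k) (v : k) (X : V -> V) (n : nat) (x : V) : V :=
  (qfact v n)^-1 *: iter n X x.

End QuantumIntegers.

Section QuantumGroup.
Variables (R : realType) (I : finType) (D : root_datum R I).
Variables (k : fieldType) (t : k).

Local Notation h := (rd_h D).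
Local Notation h' := 'Hom(h, R[i]^o).
Local Notation alpha := (rd_root D).
Local Notation coroot := (rd_coroot D).
Local Notation form := (@rd_form _ _ D).
Local Notation P := (@rd_lattice _ _ D).

(* q^c for c in (1/2d)Z, with t = q^(1/2d): 2dc is then an integer, which is the
   floor of its real part.                                                    *)
Definition qpow (c : R[i]) : k :=
  t ^ Num.floor (complex.Re (c * (2 * rd_d D)%:R)).

Definition q_ (i : I) : k := qpow (form (alpha i) (alpha i) / 2).

Definition half_lattice : set h' := [set l | P (l *+ 2)].

(* A module over the algebra presented by the generators E_i, F_i, K_l
   (l in P/2): a vector space with operators satisfying the defining relations.
   Only the K_l with l in P/2 are meaningful.                                 *)
Record uq_module := UqModule {
  uq_space :> lmodType k;
  uqE : I -> {linear uq_space -> uq_space};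
  uqF : I -> {linear uq_space -> uq_space};
  uqK : h' -> {linear uq_space -> uq_space};
  uqK0 : forall v, uqK 0 v = v;
  uqKD : forall l m v, half_lattice l -> half_lattice m ->
    uqK l (uqK m v) = uqK (l + m) v;
  uqKE : forall l i v, half_lattice l ->
    uqK l (uqE i v) = qpow (form l (alpha i)) *: uqE i (uqK l v);
  uqKF : forall l i v, half_lattice l ->
    uqK l (uqF i v) = qpow (- form l (alpha i)) *: uqF i (uqK l v);
  uqEF : forall i j v,
    uqE i (uqF j v) - uqF j (uqE i v) =
      if i == j then (q_ i - (q_ i)^-1)^-1 *: (uqK (alpha i) v - uqK (- alpha i) v)
      else 0;
  uq_serreE : forall i j v, i != j ->
    \sum_(r < `|(1 - rd_cartan D i j)%R|.+1)
      (-1) ^+ r *: divided_power (q_ i) (uqE i) r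
        (uqE j (divided_power (q_ i) (uqE i) (`|(1 - rd_cartan D i j)%R| - r)%N v)) = 0;
  uq_serreF : forall i j v, i != j ->
    \sum_(r < `|(1 - rd_cartan D i j)%R|.+1)
      (-1) ^+ r *: divided_power (q_ i) (uqF i) r
        (uqF j (divided_power (q_ i) (uqF i) (`|(1 - rd_cartan D i j)%R| - r)%N v)) = 0
}.

Section Module.
Variable V : uq_module.

Definition weight_vector (b : h') (v : V) : Prop :=
  forall l, half_lattice l -> uqK V l v = qpow (form l b) *: v.

Definition weight_decomposition (v : V) (bs : seq h') (x : h' -> V) : Prop :=
  [/\ uniq bs, forall b, b \in bs -> P b /\ weight_vector b (x b) &
      v = \sum_(b <- bs) x b].

Definition weight_module : Prop :=
  (forall v, exists bs, exists x, weight_decomposition v bs x) /\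
  (forall bs x, weight_decomposition 0 bs x -> forall b, b \in bs -> x b = 0).

Definition locally_nilpotent (f : V -> V) : Prop :=
  forall v, exists n, iter n f v = 0.

(* The component of U_q^+ of degree \sum_i n_i alpha_i is spanned by the words in
   the E_i in which each E_i occurs n_i times.                                *)
Definition locally_Uplus_finite : Prop :=
  forall v, exists N : nat, forall n : I -> nat, (N <= \sum_i n i)%N ->
    forall w : seq I, (forall i, count_mem i w = n i) ->
      foldr (fun i => uqE V i) v w = 0.

Definition category_Oint : Prop :=
  [/\ weight_module, forall i, locally_nilpotent (uqE V i),
      forall i, locally_nilpotent (uqF V i) & locally_Uplus_finite].

(* F_{w,l} for w = [:: i_1; ...; i_m]; the coroot alpha_{i_1}^vee is successively
   reflected by s_{i_2}, ..., s_{i_m}.                                        *)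
Fixpoint F_word (l : h') (w : seq I) (v : V) : V :=
  if w is i :: w' then
    divided_power (q_ i) (uqF V i)
      (Num.truncn (complex.Re
        (l (foldl (fun (x : h) j => coreflection j x) (coroot i) w'))))
      (F_word l w' v)
  else v.

Definition sigma_spec (J : {set I}) (f : {linear V -> V}) : Prop :=
  [/\ forall v, (forall j, j \in J -> uqE V j v = 0) ->
        forall bs x w, weight_decomposition v bs x ->
          reduced_word D J w -> word_prod D w = longest D J ->
          f v = \sum_(b <- bs) F_word b w (x b),
      forall j v, j \in J -> f (uqF V j v) = uqE V (star D J j) (f v) &
      forall j v, j \in J -> f (uqE V j v) = uqF V (star D J j) (f v)].

Definition is_sigma (J : {set I}) (f : {linear V -> V}) : Prop :=
  sigma_spec J f /\ forall g : {linear V -> V}, sigma_spec J g -> g =1 f.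

Definition cactus_action (rho : cactus D -> {linear V -> V}) : Prop :=
  [/\ forall v, rho 1%g v = v,
      forall x y v, rho (x * y)%g v = rho x (rho y v) &
      forall J, is_sigma (val J) (rho (tau J))].

End Module.

(* For V in O^int the action tau_J |-> sigma^J_V exists, and is_sigma pins down
   its values on generators, hence the action itself; "x lies in the kernel of
   the action" is phrased by quantifying the action existentially.            *)
Definition cactus_kernel : set (cactus D) :=
  [set x | forall V : uq_module, category_Oint V ->
     exists2 rho : cactus D -> {linear V -> V},
       cactus_action rho & forall v, rho x v = v].

End QuantumGroup.

Arguments cactus_kernel {R I} D {k} t _.

(* Main.v *)
Require Import Defs.
From HB Require Import structures.
From mathcomp Require Import all_boot all_order all_algebra.
From mathcomp Require Import complex.
From mathcomp Require Import boolp classical_sets cardinality functions reals.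
From mathcomp Require Import zify ring.
Set Implicit Arguments.
Unset Strict Implicit.
Unset Printing Implicit Defensive.
Import Order.TTheory GRing.Theory Num.Theory.
Local Open Scope ring_scope.

(** The natural epimorphism [psi : tau_J |-> w_J] exists because the longest
    elements satisfy the cactus relations: [w_J] is an involution, it is
    multiplicative over orthogonal unions, and it conjugates [w_K] to
    [w_(star K)] for [K] contained in [J]. All three follow from one
    characterization ([negative_longest]): in a finite parabolic subgroup, [w_J]
    is the only element that makes every simple root of [J] negative. Behind it
    is the sign theorem [root_positive]: if [l(w s_i) >= l(w)], then [w alpha_i]
    is a nonnegative combination of simple roots. It is proved by reduction to
    dihedral subgroups, where the roots are computed explicitly.

    The epimorphism factors through the quotient by the kernel of the action
    because the operators remember the Weyl group: [sigma^J] maps vectors of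
    weight [b] to vectors of weight [w_J b] ([sigma_weight]). This is a
    consequence of the uniqueness of [sigma^J]. For [l] in [P/2] the operator
    [K_(- w_J l) sigma^J K_l] satisfies the conditions that characterize
    [sigma^J] ([twist_sigma]), so the two are equal, that is,
    [sigma^J K_l = K_(w_J l) sigma^J]. If [x] acts as the identity on a module
    with a nonzero vector of weight [lam], then this vector has the weights
    [lam] and [psi x lam], which must therefore coincide.

    Hence it is enough to have, for every dominant [lam] in [P], a module in the
    category with a nonzero vector of weight [lam]: an element of the Weyl group
    that fixes all dominant weights of [P] is the identity ([weyl_eq1]). The
    irreducible highest weight module is constructed inside the space of
    functions on the words in [I]. A vector [v] is represented by the function
    whose value at a word [w] is the coefficient of the highest weight vector in
    [E_w v]. In this model [E_i] is a shift and [F_i] an explicit sum over the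
    occurrences of [i] in the word ([lowering_at]), and a function that is killed
    by all the [E_i] and vanishes at the empty word is zero. The quantum Serre
    expression in the [F_i] commutes with all the [E_m], and symmetrically
    ([serre_commute]), which gives both families of Serre relations. The same
    principle gives [F_i^(n+1) v = 0] for the highest weight vector [v] and
    [n = lam (alpha_i^vee)], and the Serre relations propagate the local
    nilpotency of [F_i] to the whole module ([lowering_nilpotent_step]). *)

(** * Morphisms out of presented groups and quotient groups *)

Section PresentedUniversal.
Variables (X : choiceType) (rel : seq X -> seq X -> Prop) (H : groupType).
Variable f : X -> H.

Local Notation word := (seq (X * bool)).

Definition eval_letter (p : X * bool) : H := if p.2 then f p.1 else (f p.1)^-1%g.
Definition eval_word (u : word) : H := (\prod_(p <- u) eval_letter p)%g.

Lemma eval_word_pos u : eval_word [seq (x, true) | x <- u] = (\prod_(x <- u) f x)%g.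
Proof. by rewrite /eval_word big_map. Qed.

Hypothesis f_rel : forall u v, rel u v ->
  (\prod_(x <- u) f x = \prod_(x <- v) f x)%g.

Lemma eval_word_eq u v : word_eq rel u v -> eval_word u = eval_word v.
Proof.
elim=> {u v} [u|u v _ ->|v u w _ -> _ ->|u u' v v' _ eu _ ev|x b|u v uv] //.
- by rewrite /eval_word !big_cat -!/(eval_word _) /= eu ev.
- rewrite /eval_word big_cons big_seq1 big_nil.
  by case: b; rewrite /eval_letter /= ?mulgV ?mulVg.
- by rewrite !eval_word_pos; exact: f_rel.
Qed.

Definition presented_lift (a : presented_group rel) : H := eval_word (repr a).

Lemma presented_lift_class u : presented_lift (word_class rel u) = eval_word u.
Proof. exact/eval_word_eq/word_classP/word_reprK. Qed.

Lemma presented_liftM : {morph presented_lift : x y / (x * y)%g}.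
Proof.
move=> a b; rewrite -(word_reprK a) -(word_reprK b) [X in presented_lift X]presented_mulE.
by rewrite !presented_lift_class /eval_word big_cat.
Qed.

Lemma presented_extend : exists g : {multiplicative presented_group rel -> H},
  forall x, g (presented_gen rel x) = f x.
Proof.
pose i := isMultiplicative.Build _ _ presented_lift presented_liftM.
pose g : {multiplicative presented_group rel -> H} := HB.pack presented_lift i.
exists g => x; rewrite [LHS]presented_lift_class.
by rewrite /eval_word big_seq1.
Qed.
End PresentedUniversal.

Lemma multiplicative1 (G H : groupType) (g : {multiplicative G -> H}) : g 1%g = 1%g.
Proof. by apply: (mulgI (g 1%g)); rewrite -gmulfM !mulg1. Qed.

Lemma multiplicativeV (G H : groupType) (g : {multiplicative G -> H}) x :
  g x^-1%g = (g x)^-1%g.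
Proof. by apply: (mulgI (g x)); rewrite -gmulfM !mulgV multiplicative1. Qed.

Lemma presented_ind (X : choiceType) (rel : seq X -> seq X -> Prop)
    (P : presented_group rel -> Prop) :
  P 1%g -> (forall x, P (presented_gen rel x)) -> (forall x, P (presented_gen rel x)^-1%g) ->
  (forall a b, P a -> P b -> P (a * b)%g) -> forall a, P a.
Proof.
move=> P1 Pg PV PM a; rewrite -(word_reprK a); elim: (repr a) => [|[x b] u IH] //.
rewrite -cat1s -presented_mulE; apply: PM => //; case: b; first exact: Pg.
suff -> : word_class rel [:: (x, false)] = (presented_gen rel x)^-1%g by [].
by rewrite [RHS]presented_invE.
Qed.

Lemma quotient_extend (G H : groupType) (S : set G) (g : {multiplicative G -> H}) :
  (forall x, S x -> g x = 1%g) ->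
  exists h : {multiplicative quotient_group S -> H},
    forall x, h (quotient_proj S x) = g x.
Proof.
move=> gS.
have gN x : normal_closure S x -> g x = 1%g.
  elim=> {x} [|x [y Sy [h ->]]|x y _ gx _ gy|x _ gx].
  - exact: multiplicative1.
  - by rewrite /conjg !gmulfM multiplicativeV (gS y) // mul1g mulVg.
  - by rewrite gmulfM gx gy mulg1.
  - by rewrite multiplicativeV gx invg1.
pose h (a : quotient_group S) := g (repr a).
have hE x : h (quotient_proj S x) = g x.
  have /quotient_projP/gN := quotient_reprK (quotient_proj S x).
  rewrite gmulfM multiplicativeV => e.
  by apply: (mulgI (g (repr (quotient_proj S x)))^-1%g); rewrite e mulVg.
have hM : {morph h : x y / (x * y)%g}.
  move=> a b; rewrite -(quotient_reprK a) -(quotient_reprK b).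
  by rewrite [X in h X]quotient_mulE !hE gmulfM.
pose i := isMultiplicative.Build _ _ h hM.
by exists (HB.pack h i : {multiplicative quotient_group S -> H}).
Qed.

(** * The action of the Weyl group on weights *)

Section WeylAction.
Variables (R : realType) (I : finType) (D : root_datum R I).

Local Notation h := (rd_h D).
Local Notation h' := 'Hom(h, R[i]^o).
Local Notation alpha := (rd_root D).
Local Notation coroot := (rd_coroot D).
Local Notation form := (@rd_form _ _ D).
Local Notation P := (@rd_lattice _ _ D).
Local Notation s := (simple_reflection D).
Local Notation W := (weyl D).
Local Notation wp := (word_prod D).

Lemma rformDl l l' m : form (l + l') m = form l m + form l' m.
Proof. by have := rd_form_scalar m 1 l l'; rewrite scale1r mul1r. Qed.
Lemma rformZl a l m : form (a *: l) m = a * form l m.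
Proof.
have e0 : form 0 m = 0 by apply: (addrI (form 0 m)); rewrite -rformDl !addr0.
by have := rd_form_scalar m a l 0; rewrite !addr0 e0 addr0.
Qed.
Lemma rformNl l m : form (- l) m = - form l m.
Proof. by rewrite -scaleN1r rformZl mulN1r. Qed.
Lemma rformBl l l' m : form (l - l') m = form l m - form l' m.
Proof. by rewrite rformDl rformNl. Qed.
Lemma rform0l m : form 0 m = 0.
Proof. by rewrite -(scale0r 0) rformZl mul0r. Qed.
Lemma rformDr l m m' : form l (m + m') = form l m + form l m'.
Proof. by rewrite !(rd_form_sym l) rformDl. Qed.
Lemma rformZr a l m : form l (a *: m) = a * form l m.
Proof. by rewrite !(rd_form_sym l) rformZl. Qed.
Lemma rformNr l m : form l (- m) = - form l m.
Proof. by rewrite !(rd_form_sym l) rformNl. Qed.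
Lemma rformBr l m m' : form l (m - m') = form l m - form l m'.
Proof. by rewrite rformDr rformNr. Qed.
Lemma rformMnl l m n : form (l *+ n) m = form l m *+ n.
Proof. by rewrite -scaler_nat rformZl mulr_natl. Qed.
Lemma rformMnr l m n : form l (m *+ n) = form l m *+ n.
Proof. by rewrite -scaler_nat rformZr mulr_natl. Qed.
Lemma rform_sumr (J : finType) l (f : J -> h') :
  form l (\sum_j f j) = \sum_j form l (f j).
Proof.
apply: (big_morph (form l)); first exact: rformDr.
by rewrite rd_form_sym rform0l.
Qed.

Lemma rform_root_gt0 i : 0 < form (alpha i) (alpha i).
Proof. by have [n n0 ->] := rd_form_even D i; rewrite ltr0n double_gt0. Qed.

Lemma rform_root_neq0 i : form (alpha i) (alpha i) != 0.
Proof. exact: lt0r_neq0 (rform_root_gt0 i). Qed.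

Lemma coroot_form (l : h') i : l (coroot i) * form (alpha i) (alpha i) = 2 * form l (alpha i).
Proof. by rewrite rd_corootE divfK // rform_root_neq0. Qed.

Lemma cartan_diag i : rd_cartan D i i = 2.
Proof. by have [-> _ _] := rd_cartanP D. Qed.

Lemma cartan_le0 i j : i != j -> rd_cartan D i j <= 0.
Proof. by have [_ H _] := rd_cartanP D; apply: H. Qed.

Lemma cartan_zero_sym i j : rd_cartan D i j = 0 -> rd_cartan D j i = 0.
Proof. by have [_ _ H] := rd_cartanP D; apply: H. Qed.

Lemma root_coroot i : alpha i (coroot i) = 2.
Proof. by rewrite rd_pairing cartan_diag. Qed.

(** Linear independence of the simple roots, in the form that compares
    coefficients indexed by [I]. *)
Lemma root_coeff_inj (c d : I -> R[i]) :
  \sum_k c k *: alpha k = \sum_k d k *: alpha k -> c =1 d.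
Proof.
move=> e; suff H (f : I -> R[i]) : \sum_k f k *: alpha k = 0 -> f =1 fun=> 0.
  move=> i; apply/eqP; rewrite -subr_eq0; apply/eqP.
  apply: (H (fun k => c k - d k)).
  under eq_bigr do rewrite scalerBl.
  by rewrite sumrB e subrr.
move=> f0 i; have /freeP fr := rd_root_free D.
rewrite -(enum_rankK i); apply: (fr (fun o => f (enum_val o))).
rewrite -[RHS]f0 (reindex (@enum_val I I)) /=; last first.
  by exists enum_rank => o _; rewrite ?enum_valK ?enum_rankK.
apply: eq_bigr => o _; congr (_ *: _).
by rewrite (nth_map i) -?cardE // [enum_val _](enum_val_nth i).
Qed.

Lemma root_delta_sum (c : R[i]) x : \sum_k ((k == x)%:R * c) *: alpha k = c *: alpha x.
Proof.
rewrite (bigD1 x) //= eqxx mul1r big1 ?addr0 // => k /negPf ->.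
by rewrite mul0r scale0r.
Qed.

Lemma root_inj : injective alpha.
Proof.
move=> i j e; apply/eqP; apply: contraT => ne.
have := @root_coeff_inj (fun k => (k == i)%:R * 1) (fun k => (k == j)%:R * 1).
rewrite !root_delta_sum !scale1r => /(_ e i).
by rewrite eqxx (negPf ne) mulr1 mul0r => /eqP; rewrite oner_eq0.
Qed.

Lemma root_neq0 i : alpha i != 0.
Proof.
by apply/eqP => e; have := rform_root_gt0 i; rewrite e rform0l ltxx.
Qed.

Definition act (w : W) : 'End(h') := val (val w).

Lemma act1 l : act 1%g l = l.
Proof. by rewrite /act /= lfunE. Qed.
Lemma actM x y l : act (x * y)%g l = act x (act y l).
Proof. by rewrite /act /= comp_lfunE. Qed.
Lemma actVK x l : act x^-1%g (act x l) = l.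
Proof. by rewrite -actM mulVg act1. Qed.
Lemma actKV x l : act x (act x^-1%g l) = l.
Proof. by rewrite -actM mulgV act1. Qed.
Lemma act_s i l : act (s i) l = l - l (coroot i) *: alpha i.
Proof. by rewrite /act /= lfunE. Qed.
Lemma act_inj x y : (forall l, act x l = act y l) -> x = y.
Proof. by move=> e; apply/val_inj/val_inj/lfunP. Qed.
Lemma act_injective x : injective (act x).
Proof. exact: can_inj (actVK x). Qed.

Lemma act_s_root i : act (s i) (alpha i) = - alpha i.
Proof. by rewrite act_s root_coroot scaler_nat mulr2n opprD addNKr. Qed.

Lemma mulss i : (s i * s i = 1)%g.
Proof.
by apply: act_inj => l; rewrite actM act1 !act_s -!/(reflection _ _) reflectionK.
Qed.
Lemma invs i : ((s i)^-1 = s i)%g.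
Proof. by apply: (mulgI (s i)); rewrite mulgV mulss. Qed.

Lemma s_inj : injective s.
Proof.
move=> i j e; have := act_s_root i; rewrite e act_s => e'.
apply/root_inj.
have e2 : alpha i *+ 2 = alpha i (coroot j) *: alpha j.
  by rewrite mulr2n -{1}[alpha i]opprK -e' opprB subrK.
apply/eqP; apply: contraT => ne.
have nij : i != j by apply: contraNneq ne => ->.
have := @root_coeff_inj (fun k => (k == i)%:R * 2)
  (fun k => (k == j)%:R * alpha i (coroot j)).
rewrite !root_delta_sum scaler_nat => /(_ e2 i).
by rewrite eqxx (negPf nij) mul0r mul1r => /eqP; rewrite pnatr_eq0.
Qed.

Lemma wp_nil : wp [::] = 1%g. Proof. by rewrite /word_prod big_nil. Qed.
Lemma wp_cons i u : wp (i :: u) = (s i * wp u)%g.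
Proof. by rewrite /word_prod big_cons. Qed.
Lemma wp_cat u v : wp (u ++ v) = (wp u * wp v)%g.
Proof. by rewrite /word_prod big_cat. Qed.
Lemma wp_rcons u i : wp (rcons u i) = (wp u * s i)%g.
Proof. by rewrite -cats1 wp_cat wp_cons wp_nil mulg1. Qed.
Lemma wp_rev u : wp (rev u) = (wp u)^-1%g.
Proof.
elim: u => [|i u IH]; first by rewrite !wp_nil invg1.
by rewrite rev_cons wp_rcons IH wp_cons invgM invs.
Qed.

Lemma parabolicP (J : {set I}) x :
  parabolic J x <-> exists u, all [in J] u /\ wp u = x.
Proof.
split=> [|[u [uJ <-]]].
  elim=> {x} [|x [j jJ <-]|x y _ [u [uJ <-]] _ [v [vJ <-]]|x _ [u [uJ <-]]].
  - by exists [::]; rewrite wp_nil.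
  - by exists [:: j]; split; rewrite /= ?andbT // wp_cons wp_nil mulg1.
  - by exists (u ++ v); rewrite all_cat uJ vJ wp_cat.
  - by exists (rev u); rewrite all_rev wp_rev.
elim: u uJ => [|j u IH] /=; first by rewrite wp_nil => _; exact: gen_one.
case/andP=> jJ /IH uJ; rewrite wp_cons; apply: gen_mul => //.
by apply: gen_mem; exists j.
Qed.

Lemma weyl_word (x : W) : exists u, wp u = x.
Proof.
suff H g : generated (range (linear_reflection D)) g -> exists u, val (wp u) = g.
  have /asboolP/H[u e] := valP x.
  by exists u; apply: val_inj.
elim=> {g} [|g [i _ <-]|g g' _ [u <-] _ [v <-]|g _ [u <-]].
- by exists [::]; rewrite wp_nil.
- by exists [:: i]; rewrite wp_cons wp_nil mulg1.
- by exists (u ++ v); rewrite wp_cat.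
- by exists (rev u); rewrite wp_rev.
Qed.

Lemma rform_act w l m : form (act w l) (act w m) = form l m.
Proof.
have [u <-] := weyl_word w.
elim: u l m => [|i u IH] l m; first by rewrite wp_nil !act1.
rewrite wp_cons !actM -[RHS]IH; move: (act _ l) (act _ m) => {}l {}m.
rewrite !act_s rformBl !rformBr !rformZl !rformZr.
have := coroot_form l i; have := coroot_form m i.
rewrite (rd_form_sym (alpha i) m).
move: (form l (alpha i)) (form m (alpha i)) (form (alpha i) _) (l _) (m _) (form l m).
move=> a b c d e f h1 h2.
have -> : a = d * c / 2 by rewrite h2; field.
have -> : b = e * c / 2 by rewrite h1; field.
by field.
Qed.

(** The pairing of [w l] with a coroot is read off from [w^-1 alpha_i], through
    the invariant form. *)
Lemma coroot_act w (l : h') i :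
  act w l (coroot i) * form (alpha i) (alpha i) = 2 * form l (act w^-1%g (alpha i)).
Proof. by rewrite coroot_form -(rform_act w l) actKV. Qed.

Lemma lattice0 : P 0.
Proof.
by have [b _ bP] := rd_latticeP D; apply/bP; exists (fun=> 0); rewrite big1.
Qed.
Lemma latticeB l m : P l -> P m -> P (l - m).
Proof.
have [b _ bP] := rd_latticeP D; move=> /bP[y ->] /bP[z ->]; apply/bP.
exists (fun i => y i - z i); rewrite -sumrB; apply: eq_bigr => i _.
by rewrite mulrzBr.
Qed.
Lemma latticeN l : P l -> P (- l).
Proof. by move=> Pl; rewrite -sub0r; apply: latticeB => //; exact: lattice0. Qed.
Lemma latticeD l m : P l -> P m -> P (l + m).
Proof. by move=> Pl Pm; rewrite -[m]opprK; apply: latticeB => //; exact: latticeN. Qed.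
Lemma latticeMn l n : P l -> P (l *+ n).
Proof.
move=> Pl; elim: n => [|n IH]; first by rewrite mulr0n; exact: lattice0.
by rewrite mulrS; apply: latticeD.
Qed.
Lemma latticeMz l z : P l -> P (l *~ z).
Proof.
move=> Pl; case: z => n; first exact: latticeMn.
by rewrite NegzE mulrNz; apply/latticeN/latticeMn.
Qed.

Lemma lattice_sum (J : finType) (f : J -> h') : (forall j, P (f j)) -> P (\sum_j f j).
Proof. by move=> Pf; apply: big_ind; [exact: lattice0|exact: latticeD|]. Qed.

Lemma lattice_basis : exists2 e : (\dim {:h'}).-tuple h', basis_of {:h'} e &
  forall i, P (tnth e i).
Proof.
have [e be eP] := rd_latticeP D; exists e => // i.
apply/eP; exists (fun j => (j == i)%:Z).
by rewrite (bigD1 i) //= eqxx mulr1z big1 ?addr0 // => j /negPf ->; rewrite mulr0z.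
Qed.

Lemma lattice_act w l : P l -> P (act w l).
Proof.
have [u <-] := weyl_word w.
elim: u l => [|i u IH] l Pl; first by rewrite wp_nil act1.
rewrite wp_cons actM act_s; apply: latticeB; first exact: IH.
have [z ->] := rd_lattice_int i (IH _ Pl).
rewrite scaler_int; apply: latticeMz; exact: rd_root_lattice.
Qed.

(** The coefficients are natural numbers rather than nonnegative reals because
    [longest_permutes] turns a matrix of such coefficients into a permutation. *)
Definition root_cone (J : {set I}) (l : h') : Prop :=
  exists2 n : I -> nat, (forall k, k \notin J -> n k = 0%N) & l = \sum_k alpha k *+ n k.

Lemma root_coneD J l m : root_cone J l -> root_cone J m -> root_cone J (l + m).
Proof.
move=> [p hp ->] [q hq ->]; exists (fun k => (p k + q k)%N) => [k kJ|].
  by rewrite hp ?hq.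
by rewrite -big_split; apply: eq_bigr => k _; rewrite mulrnDr.
Qed.
Lemma root_cone0 J : root_cone J 0.
Proof. by exists (fun=> 0%N) => //; rewrite big1. Qed.
Lemma root_coneMn J l n : root_cone J l -> root_cone J (l *+ n).
Proof.
move=> hl; elim: n => [|n IH]; first exact: root_cone0.
by rewrite mulrS; apply: root_coneD.
Qed.
Lemma root_cone_root (J : {set I}) j : j \in J -> root_cone J (alpha j).
Proof.
move=> jJ; exists (fun k => (k == j) : nat) => [k|].
  by case: eqP => // ->; rewrite jJ.
rewrite (bigD1 j) //= eqxx big1 ?addr0 // => k /negPf ->.
by rewrite mulr0n.
Qed.
Lemma root_cone_sub (J K : {set I}) l : J \subset K -> root_cone J l -> root_cone K l.
Proof.
move=> /fintype.subsetP JK [n hn ->]; exists n => // k kK; apply: hn.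
by apply: contra kK; exact: JK.
Qed.
Lemma root_cone_sum (J : {set I}) (n : I -> nat) (f : I -> h') :
  (forall k, k \notin J -> n k = 0%N) -> (forall k, k \in J -> root_cone J (f k)) ->
  root_cone J (\sum_k f k *+ n k).
Proof.
move=> hn hf; apply: big_ind; [exact: root_cone0|exact: root_coneD|move=> k _].
have [kJ|kJ] := boolP (k \in J); first exact/root_coneMn/hf.
by rewrite hn //; exact: root_cone0.
Qed.

Lemma root_natr (n : I -> nat) : \sum_k alpha k *+ n k = \sum_k (n k)%:R *: alpha k.
Proof. by apply: eq_bigr => k _; rewrite scaler_nat. Qed.

Lemma root_nat_inj (m n : I -> nat) :
  \sum_k alpha k *+ m k = \sum_k alpha k *+ n k -> m =1 n.
Proof.
rewrite !root_natr => /root_coeff_inj e k; have /eqP := e k.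
by rewrite eqr_nat => /eqP.
Qed.

Lemma root_cone_opp (J K : {set I}) l : root_cone J l -> root_cone K (- l) -> l = 0.
Proof.
move=> [m _ ->] [n _ e].
have : \sum_k alpha k *+ (m k + n k) = \sum_k alpha k *+ (fun=> 0%N) k.
  rewrite [RHS]big1 //; under eq_bigr do rewrite mulrnDr.
  by rewrite big_split /= -e subrr.
move=> /root_nat_inj e0; rewrite big1 // => k _.
by have /eqP := e0 k; rewrite addn_eq0 => /andP[/eqP -> _].
Qed.
End WeylAction.

(** * Reflections in two simple roots *)

(** Letters are added in front, where the next reflection acts; the last letter
    is [x] for every positive length. *)
Fixpoint alternating (I : Type) (x y : I) n : seq I :=
  if n is n'.+1 then (if odd n' then y else x) :: alternating x y n' else [::].

Lemma size_alternating (I : Type) (x y : I) n : size (alternating x y n) = n.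
Proof. by elim: n => //= n ->. Qed.

Lemma alternating_rcons (I : Type) (x y : I) n :
  alternating x y n.+1 = rcons (alternating y x n) x.
Proof.
elim: n => //= n IH; rewrite IH.
by case: (odd n).
Qed.

Lemma alternating_suffix (I : Type) (x y : I) n m :
  exists2 u, size u = n & alternating x y (n + m) = u ++ alternating x y m.
Proof.
elim: n => [|n [u su IH]]; first by exists [::].
by rewrite addSn /= IH; eexists (_ :: u); rewrite /= ?su.
Qed.

Lemma all_alternating (I : eqType) (x y : I) (p : pred I) n :
  p x -> p y -> all p (alternating x y n).
Proof. by move=> px py; elim: n => //= n ->; case: (odd n); rewrite ?px ?py. Qed.

Lemma all_catl (T : Type) (p : pred T) (u v : seq T) : all p (u ++ v) -> all p u.
Proof. by rewrite all_cat => /andP[]. Qed.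

(** The coefficients of [alpha_y] and [alpha_x] in the image of [alpha_y] under
    the alternating word of length [n], if [s_y alpha_x = alpha_x + a alpha_y] and
    [s_x alpha_y = alpha_y + b alpha_x]; see [act_alternating]. *)
Fixpoint rank2_coeffs (a b : int) n : int * int :=
  if n is n'.+1 then
    let: (p, q) := rank2_coeffs a b n' in if odd n' then (a * q - p, q) else (p, b * p - q)
  else (1, 0).

(** The coefficients [A] and [B] in the image [l - A alpha_y - B alpha_x], under
    the same word, of a weight [l] with [l (alpha_x^vee) = X] and
    [l (alpha_y^vee) = Y]; see [act_alternating_weight]. *)
Fixpoint alternating_coeffs (F : pzRingType) (a b X Y : F) n : F * F :=
  if n is n'.+1 then
    let: (A, B) := alternating_coeffs a b X Y n' in
    if odd n' then (Y - A + a * B, B) else (A, X - B + b * A)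
  else (0, 0).

(** The order of [s_x s_y], with [6] as the value for [a * b = 3] and as a
    default for [4 <= a * b], where the order is infinite. *)
Definition coxeter_number (a b : int) : nat :=
  if a * b == 0 then 2 else if a * b == 1 then 3 else if a * b == 2 then 4 else 6.

Lemma small_product (a b : int) : 0 <= a -> 0 <= b -> (a = 0 <-> b = 0) -> a * b < 4 ->
  [\/ a = 0 /\ b = 0, a = 1 /\ b = 1, a = 1 /\ b = 2 |
     [\/ a = 2 /\ b = 1, a = 1 /\ b = 3 | a = 3 /\ b = 1]].
Proof.
move=> a0 b0 ab lt.
have [az|az] := eqVneq a 0; first by constructor 1; split=> //; apply/ab.
have bz : b != 0 by apply: contraNneq az => /ab ->.
have a4 : a < 4 by nia.
have b4 : b < 4 by nia.
have : a \in [:: 1; 2; 3] by rewrite !inE; lia.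
have : b \in [:: 1; 2; 3] by rewrite !inE; lia.
rewrite !inE => /or3P[] /eqP hb /or3P[] /eqP ha; rewrite ha hb in lt *; try by [];
 first [by constructor 2|by constructor 3|by constructor 4; constructor 1
  |by constructor 4; constructor 2|by constructor 4; constructor 3].
Qed.

Lemma rank2_coeffs_ge0 (a b : int) n : 0 <= a -> 0 <= b -> (a = 0 <-> b = 0) ->
  a * b < 4 -> (n < coxeter_number a b)%N ->
  0 <= (rank2_coeffs a b n).1 /\ 0 <= (rank2_coeffs a b n).2.
Proof.
move=> a0 b0 ab /(small_product a0 b0 ab).
by case=> [|||[||]] [-> ->]; rewrite /coxeter_number /=; do 7 (case: n => [|n] //).
Qed.

(** Nonnegativity alone is not inductive. The last clause says that the last
    reflection did not decrease the coefficient that it changed, and [4 <= a * b]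
    makes this true of the next one. *)
Lemma rank2_coeffs_ge0_infinite (a b : int) n : 0 <= a -> 0 <= b -> 4 <= a * b ->
  let: (p, q) := rank2_coeffs a b n in
  [/\ 0 <= p, 0 <= q & if odd n then b * p <= 2 * q else a * q <= 2 * p].
Proof.
move=> a0 b0 ab; elim: n => [|n] /=; first by split; lia.
case: (rank2_coeffs a b n) => p q [p0 q0]; case: (odd n) => /= h; split => //.
- by nia.
- by nia.
- by nia.
- by nia.
Qed.

Section RankTwo.
Variables (R : realType) (I : finType) (D : root_datum R I).

Local Notation h := (rd_h D).
Local Notation h' := 'Hom(h, R[i]^o).
Local Notation alpha := (rd_root D).
Local Notation coroot := (rd_coroot D).
Local Notation s := (simple_reflection D).
Local Notation wp := (word_prod D).

Variables x y : I.
Hypothesis nxy : x != y.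
Let a : int := - rd_cartan D y x.
Let b : int := - rd_cartan D x y.

Let act_yx : act (s y) (alpha x) = alpha x + alpha y *~ a.
Proof. by rewrite act_s rd_pairing mulrNz scaler_int. Qed.
Let act_xy : act (s x) (alpha y) = alpha y + alpha x *~ b.
Proof. by rewrite act_s rd_pairing mulrNz scaler_int. Qed.

Lemma act_alternating n :
  act (wp (alternating x y n)) (alpha y) =
    alpha y *~ (rank2_coeffs a b n).1 + alpha x *~ (rank2_coeffs a b n).2.
Proof.
elim: n => [|n IH]; first by rewrite wp_nil act1 mulr1z addr0.
rewrite wp_cons actM IH /=; case: (rank2_coeffs a b n) => p q /=.
case: (odd n); rewrite linearD !raddfMz /= act_s_root ?act_yx ?act_xy.
  by rewrite mulrzDl -mulrzA mulrzBr mulNrz addrC -addrA addrC.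
by rewrite mulrzDl -mulrzA mulrzBr mulNrz addrA.
Qed.

Let stepx (l : h') (A B : R[i]) :
  act (s x) (l - A *: alpha y - B *: alpha x) =
  l - A *: alpha y - (l (coroot x) - B + b%:~R * A) *: alpha x.
Proof.
transitivity (act (s x) l - A *: act (s x) (alpha y) - B *: act (s x) (alpha x)).
  by rewrite !linearB !linearZ.
rewrite act_xy act_s_root act_s -(scaler_int b) scalerDr scalerA [A * _]mulrC.
rewrite scalerN !scalerDl scaleNr !opprD !opprK -!addrA.
by rewrite (addrCA (- (l (coroot x) *: alpha x))) [B *: _ - _]addrC.
Qed.
Let stepy (l : h') (A B : R[i]) :
  act (s y) (l - A *: alpha y - B *: alpha x) =
  l - (l (coroot y) - A + a%:~R * B) *: alpha y - B *: alpha x.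
Proof.
transitivity (act (s y) l - A *: act (s y) (alpha y) - B *: act (s y) (alpha x)).
  by rewrite !linearB !linearZ.
rewrite act_yx act_s_root act_s -(scaler_int a) scalerDr scalerA [B * _]mulrC.
rewrite scalerN !scalerDl scaleNr !opprD !opprK -!addrA.
by rewrite [- (B *: _) - _]addrC.
Qed.

Lemma act_alternating_weight n (l : h') :
  let: (A, B) := alternating_coeffs a%:~R b%:~R (l (coroot x)) (l (coroot y)) n in
  act (wp (alternating x y n)) l = l - A *: alpha y - B *: alpha x.
Proof.
elim: n => [|n IH] /=; first by rewrite wp_nil act1 !scale0r !subr0.
case: (alternating_coeffs _ _ _ _ n) IH => A B IH.
by rewrite wp_cons actM IH; case: (odd n); [exact: stepy|exact: stepx].
Qed.

End RankTwo.

(** Both words act on a weight by subtracting multiples of the same two roots, so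
    the relation is an identity between these multiples, for each of the six
    finite rank two types. *)
Lemma braid_relation (R : realType) (I : finType) (D : root_datum R I) (x y : I) :
  x != y -> let a := - rd_cartan D y x in let b := - rd_cartan D x y in a * b < 4 ->
  word_prod D (alternating x y (coxeter_number a b)) =
  word_prod D (alternating y x (coxeter_number a b)).
Proof.
move=> nxy a b.
have a0 : 0 <= a by rewrite oppr_ge0 cartan_le0 // eq_sym.
have b0 : 0 <= b by rewrite oppr_ge0 cartan_le0.
have ab0 : a = 0 <-> b = 0.
  by split=> /eqP; rewrite oppr_eq0 => /eqP/cartan_zero_sym e; rewrite /a /b e oppr0.
move=> /(small_product a0 b0 ab0) cases; apply: act_inj => l.
set m := coxeter_number a b.
have := @act_alternating_weight _ _ D x y m l.
have := @act_alternating_weight _ _ D y x m l; rewrite -/a -/b.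
move: (l (rd_coroot D x)) (l (rd_coroot D y)) => X Y.
suff : alternating_coeffs b%:~R a%:~R Y X m =
   ((alternating_coeffs a%:~R b%:~R X Y m).2, (alternating_coeffs a%:~R b%:~R X Y m).1).
  by move=> ->; case: (alternating_coeffs _ _ X Y m) => A B /= -> ->; rewrite addrAC.
by rewrite /m; case: cases => [|||[||]] [-> ->]; rewrite /coxeter_number /=;
  congr pair; ring.
Qed.

(** * Lengths and signs of roots *)

Section Positivity.
Variables (R : realType) (I : finType) (D : root_datum R I).

Local Notation h := (rd_h D).
Local Notation h' := 'Hom(h, R[i]^o).
Local Notation alpha := (rd_root D).
Local Notation s := (simple_reflection D).
Local Notation W := (weyl D).
Local Notation wp := (word_prod D).

Definition has_word (J : {set I}) (x : W) (n : nat) : bool :=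
  `[< exists u, [/\ all [in J] u, wp u = x & size u = n] >].

(** The length in the generators [s_j] with [j] in [J], with value [0] outside the
    parabolic subgroup of [J]. *)
Definition wlen (J : {set I}) (x : W) : nat :=
  if pselect (exists n, has_word J x n) is left e then ex_minn e else 0%N.

Lemma wlen_le (J : {set I}) u : all [in J] u -> (wlen J (wp u) <= size u)%N.
Proof.
move=> uJ; have H : has_word J (wp u) (size u) by apply/asboolP; exists u.
rewrite /wlen; case: pselect => [e|[]]; last by exists (size u).
by case: ex_minnP => m _; apply.
Qed.

Lemma wlen_word (J : {set I}) x : parabolic J x ->
  exists2 u, reduced_word D J u & wp u = x /\ size u = wlen J x.
Proof.
move=> /parabolicP[u [uJ ux]].
have H : has_word J x (size u) by apply/asboolP; exists u.
have : has_word J x (wlen J x).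
  rewrite /wlen; case: pselect => [e|[]]; last by exists (size u).
  by case: ex_minnP.
move=> /asboolP[v [vJ vx sv]]; exists v => //; split=> // w wJ wv.
by rewrite sv -vx -wv; exact: wlen_le.
Qed.

Lemma reduced_wlen (J : {set I}) u : reduced_word D J u <-> all [in J] u /\ size u = wlen J (wp u).
Proof.
split=> [[uJ umin]|[uJ su]]; last first.
  by split=> // v vJ vu; rewrite su -vu; exact: wlen_le.
split=> //; apply/eqP; rewrite eqn_leq wlen_le // andbT.
have [|v [vJ _] [vu sv]] := @wlen_word J (wp u); first by apply/parabolicP; exists u.
by rewrite -sv; apply: umin.
Qed.

Lemma parabolic_word (J : {set I}) u : all [in J] u -> parabolic J (wp u).
Proof. by move=> uJ; apply/parabolicP; exists u. Qed.

Lemma parabolic_s (J : {set I}) j : j \in J -> parabolic J (s j).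
Proof. by move=> jJ; apply: gen_mem; exists j. Qed.

Lemma wlen_inv (J : {set I}) x : parabolic J x -> wlen J x^-1%g = wlen J x.
Proof.
suff H y : parabolic J y -> (wlen J y^-1%g <= wlen J y)%N.
  move=> px; apply/eqP; rewrite eqn_leq H //= -{1}[x]invgK H //.
  exact: gen_inv.
move=> /wlen_word[u [uJ _] [<- <-]]; rewrite -wp_rev -size_rev.
by apply: wlen_le; rewrite all_rev.
Qed.

Lemma wlenM (J : {set I}) x y : parabolic J x -> parabolic J y ->
  (wlen J (x * y)%g <= wlen J x + wlen J y)%N.
Proof.
move=> /wlen_word[u [uJ _] [<- <-]] /wlen_word[v [vJ _] [<- <-]].
by rewrite -size_cat -wp_cat; apply: wlen_le; rewrite all_cat uJ.
Qed.

Lemma wlen_s (J : {set I}) j : j \in J -> (wlen J (s j) <= 1)%N.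
Proof.
by move=> jJ; have := @wlen_le J [:: j]; rewrite wp_cons wp_nil mulg1 /= jJ => ->.
Qed.

(** Two equal neighbours cancel, and a last letter [y] would be absorbed by [s_y];
    so the letters alternate and the last one is [x]. *)
Lemma reduced_alternating (x y : I) u :
  all [in [set x; y]] u ->
  (forall v, all [in [set x; y]] v -> wp v = wp u -> size u <= size v)%N ->
  (forall v, all [in [set x; y]] v -> wp v = (wp u * s y)%g -> size u <= size v)%N ->
  u = alternating x y (size u).
Proof.
move: {2}(size u) (erefl (size u)) => n; elim: n u x y => [|n IH] u x y.
  by move=> /size0nil -> _ _ _; rewrite /=.
case/lastP: u => [|u z]; first by [].
rewrite size_rcons => -[su]; rewrite all_rcons => /andP[zxy uxy] red miny.
have zx : z = x.
  move: zxy; rewrite !inE => /orP[/eqP//|/eqP zy].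
  by have := miny u uxy; rewrite zy wp_rcons -mulgA mulss mulg1 su ltnn => /(_ erefl).
clear zxy; subst z.
rewrite alternating_rcons; congr (rcons _ _).
apply: IH => //.
- by rewrite finset.setUC.
- move=> v vxy vu; have := red (rcons v x); rewrite !wp_rcons vu !size_rcons ltnS; apply => //.
  by rewrite all_rcons !inE eqxx /= finset.setUC.
- move=> v vxy vu; have := red v; rewrite wp_rcons vu => H.
  by apply/ltnW/H => //; rewrite finset.setUC.
Qed.

(** If the dihedral group is infinite, all roots obtained are positive. If it is
    finite, an alternating word at least as long as the Coxeter number would,
    after a braid relation, end with [y] and be shortened by [s_y]; below the
    Coxeter number the coefficients are nonnegative by inspection. *)
Lemma rank2_positive (x y : I) u : x != y ->
  all [in [set x; y]] u ->
  (forall v, all [in [set x; y]] v -> wp v = wp u -> size u <= size v)%N ->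
  (forall v, all [in [set x; y]] v -> wp v = (wp u * s y)%g -> size u <= size v)%N ->
  exists p q : nat, act (wp u) (alpha y) = alpha y *+ p + alpha x *+ q.
Proof.
move=> nxy uxy red miny; have ue := reduced_alternating uxy red miny.
rewrite ue act_alternating //.
set a := - _; set b := - _.
have a0 : 0 <= a by rewrite oppr_ge0 cartan_le0 // eq_sym.
have b0 : 0 <= b by rewrite oppr_ge0 cartan_le0.
have ab0 : a = 0 <-> b = 0.
  by split=> /eqP; rewrite oppr_eq0 => /eqP/cartan_zero_sym e; rewrite /a /b e oppr0.
suff [] : 0 <= (rank2_coeffs a b (size u)).1 /\ 0 <= (rank2_coeffs a b (size u)).2.
  by case: (rank2_coeffs _ _ _) => [[p|p] [q|q]] //= _ _; exists p, q.
have [ab4|ab4] := lerP 4 (a * b).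
  by have := @rank2_coeffs_ge0_infinite a b (size u) a0 b0 ab4; case: rank2_coeffs => p q [].
apply: rank2_coeffs_ge0 => //.
rewrite ltnNge; apply/negP => lem.
set m := coxeter_number a b in lem.
have m0 : (0 < m)%N by rewrite /m /coxeter_number; do 3 case: ifP => //.
have [v sv ev] := alternating_suffix x y (size u - m) m.
rewrite subnK // in ev.
have vxy : all [in [set x; y]] v.
  by apply: (@all_catl _ _ _ (alternating x y m)); rewrite -ev -ue.
have := miny (v ++ alternating x y m.-1).
rewrite all_cat vxy all_alternating ?inE ?eqxx ?orbT // => /(_ isT).
rewrite ue ev !wp_cat braid_relation // -/m -{2}(prednK m0) alternating_rcons.
rewrite wp_rcons -!mulgA mulss mulg1 => /(_ erefl).
by rewrite !size_cat !size_alternating leq_add2l leqNgt prednK ?leqnn.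
Qed.

(** Induction on the length. Let [j] be the last letter of a reduced word of [x],
    and write [x = v w] where [w] is a word in [j] and [i], the lengths add up, and
    [v] is as short as possible. Neither [s_j] nor [s_i] shortens [v] on the
    right, so [v alpha_j] and [v alpha_i] are positive by induction, while
    [w alpha_i] is a nonnegative combination of [alpha_j] and [alpha_i] by the
    rank two case. *)
Lemma root_positive (J : {set I}) x i : parabolic J x -> i \in J ->
  (wlen J x <= wlen J (x * s i)%g)%N -> root_cone J (act x (alpha i)).
Proof.
move: {2}(wlen J x).+1 (ltnSn (wlen J x)) => n; elim: n x i => // n IH x i ltn px iJ lei.
have [u0 u0red [u0x su0]] := wlen_word px.
have u0J := u0red.1.
case/lastP: u0 => [|u j] in u0red u0x su0 u0J.
  by rewrite -u0x wp_nil act1; apply: root_cone_root.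
move: u0J; rewrite all_rcons => /andP[/= jJ uJ].
rewrite wp_rcons in u0x; rewrite size_rcons in su0.
have wlu : wlen J (wp u) = size u.
  apply/eqP; rewrite eqn_leq wlen_le //=.
  have : (wlen J (wp u * s j)%g <= wlen J (wp u) + 1)%N.
    apply: leq_trans (wlenM _ _) _; [exact: parabolic_word|exact: parabolic_s|].
    by rewrite leq_add2l wlen_s.
  by rewrite u0x -su0 addn1.
have nji : j != i.
  apply/eqP => ji; move: lei; rewrite -u0x ji -mulgA mulss mulg1 wlu -ji u0x -su0.
  by rewrite ltnn.
have subJ v : all [in [set j; i]] v -> all [in J] v.
  by apply: sub_all => k; rewrite !inE => /orP[] /eqP ->.
(* The possible lengths of the left factor in a length-additive decomposition. *)
pose dec (m : nat) := `[< exists v u, [/\ parabolic J v, wlen J v = m,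
  all [in [set j; i]] u, (v * wp u)%g = x & (m + size u)%N = wlen J x] >].
have exd : exists m, dec m.
  exists (size u); apply/asboolP; exists (wp u), [:: j]; split => //.
  - exact: parabolic_word.
  - by rewrite /= !inE eqxx.
  - by rewrite wp_cons wp_nil mulg1.
  - by rewrite addn1.
have [m /asboolP[v [w [pv lv wji vw sw]]] mmin] := ex_minnP exd.
have mlt : (m < n)%N.
  apply: leq_ltn_trans (mmin (size u) _) _; last by rewrite su0.
  apply/asboolP; exists (wp u), [:: j]; split => //.
  - exact: parabolic_word.
  - by rewrite /= !inE eqxx.
  - by rewrite wp_cons wp_nil mulg1.
  - by rewrite addn1.
have vpos k : k \in [set j; i] -> root_cone J (act v (alpha k)).
  move=> kji; have kJ : k \in J by move: kji; rewrite !inE => /orP[] /eqP ->.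
  have pvk : parabolic J (v * s k)%g by apply: gen_mul => //; exact: parabolic_s.
  apply: IH => //; first by rewrite lv.
  rewrite leqNgt; apply/negP => ltk.
  suff /mmin : dec (wlen J (v * s k)%g) by rewrite leqNgt -lv ltk.
  apply/asboolP; exists (v * s k)%g, (k :: w); split => //.
  - by rewrite /= kji.
  - by rewrite wp_cons mulgA -(mulgA v) mulss mulg1.
  - have up : (wlen J v <= wlen J (v * s k)%g + 1)%N.
      rewrite -{1}[v]mulg1 -(mulss D k) mulgA.
      apply: leq_trans (wlenM pvk (parabolic_s kJ)) _.
      by rewrite leq_add2l wlen_s.
    by move: up ltk; rewrite -sw -lv /=; lia.
have lower z : all [in [set j; i]] z -> (wlen J (v * wp z)%g <= m + size z)%N.
  move=> zji; rewrite -lv; apply: leq_trans (wlenM pv _) _; first exact/parabolic_word/subJ.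
  by rewrite leq_add2l; apply/wlen_le/subJ.
have [||p [q e]] := @rank2_positive j i w nji wji.
- by move=> z zji ez; rewrite -(leq_add2l m) sw -vw -ez; exact: lower.
- move=> z zji ez; rewrite -(leq_add2l m) sw (leq_trans lei) //.
  by rewrite -vw -mulgA -ez; exact: lower.
rewrite -vw actM e linearD !raddfMn /=.
by apply: root_coneD; apply: root_coneMn; apply: vpos; rewrite !inE eqxx ?orbT.
Qed.

(** The preceding lemma applied to [x s_i], since [s_i alpha_i = - alpha_i]. *)
Lemma root_negative (J : {set I}) x i : parabolic J x -> i \in J ->
  (wlen J (x * s i)%g <= wlen J x)%N -> root_cone J (- act x (alpha i)).
Proof.
move=> px iJ le.
have := @root_positive J (x * s i)%g i; rewrite -mulgA mulss mulg1 => /(_ _ iJ le).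
rewrite actM act_s_root linearN; apply.
by apply: gen_mul => //; exact: parabolic_s.
Qed.

End Positivity.

(** * Longest elements and the cactus relations *)

Section Longest.
Variables (R : realType) (I : finType) (D : root_datum R I).

Local Notation h := (rd_h D).
Local Notation h' := 'Hom(h, R[i]^o).
Local Notation alpha := (rd_root D).
Local Notation coroot := (rd_coroot D).
Local Notation s := (simple_reflection D).
Local Notation W := (weyl D).
Local Notation wp := (word_prod D).

Lemma act_root_cone (J : {set I}) (x : W) l :
  (forall j, j \in J -> root_cone J (- act x (alpha j))) ->
  root_cone J l -> root_cone J (- act x l).
Proof.
move=> neg [n n0 ->]; rewrite linear_sum -sumrN.
under eq_bigr do rewrite raddfMn /= -mulNrn.
exact: root_cone_sum.
Qed.

(** The last letter of a reduced word of [x] is a simple root that [x] makes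
    negative; so a reduced word of [x] is empty. *)
Lemma cone_preserving_eq1 (J : {set I}) (x : W) : parabolic J x ->
  (forall j, j \in J -> root_cone J (act x (alpha j))) -> x = 1%g.
Proof.
move=> px pos; have [u [uJ _] [ux su]] := wlen_word px.
case/lastP: u => [|u j] in uJ ux su; first by rewrite -ux wp_nil.
move: uJ; rewrite all_rcons => /andP[/= jJ uJ].
have := pos j jJ; have /(root_negative px jJ) neg : (wlen J (x * s j)%g <= wlen J x)%N.
  rewrite -su -ux wp_rcons -mulgA mulss mulg1 size_rcons.
  by apply: leq_trans (wlen_le _ uJ) _; exact: leqnSn.
move=> /root_cone_opp /(_ neg) e.
by have /eqP := root_neq0 D j; case; apply: (@act_injective _ _ _ x); rewrite e linear0.
Qed.

Lemma is_longestP (J : {set I}) (x : W) : is_longest J x <->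
  parabolic J x /\ forall y : W, parabolic J y -> (wlen J y <= wlen J x)%N.
Proof.
split=> [[w [wr wx wmax]]|[px xmax]].
  have [wJ sw] := (reduced_wlen D J w).1 wr.
  split; first by rewrite -wx; exact: parabolic_word.
  by move=> y /wlen_word[u ur [_ <-]]; rewrite -wx -sw; exact: wmax.
have [u ur [ux su]] := wlen_word px; exists u; split=> // v vr.
have [vJ sv] := (reduced_wlen D J v).1 vr.
by rewrite sv su; apply/xmax/parabolic_word.
Qed.

(** The lengths in a finite parabolic subgroup are bounded. *)
Lemma longestP (J : {set I}) : finite_type D J -> is_longest J (longest D J).
Proof.
case/andP=> _ /asboolP /finite_seqP[t tE].
suff [x px] : exists x : W, is_longest J x by exact: xgetI px.
pose P n := `[< exists2 x : W, parabolic J x & wlen J x = n >].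
have exP : exists n, P n.
  by exists (wlen J (1%g : W)); apply/asboolP; exists 1%g => //; exact: gen_one.
have ub n : P n -> (n <= \max_(x <- t) wlen J x)%N.
  move=> /asboolP[x px <-].
  have xt : x \in t by have : parabolic J x := px; rewrite tE.
  by rewrite (big_rem x) //= leq_maxl.
have [n /asboolP[x px xn] nmax] := ex_maxnP exP ub.
exists x; apply/is_longestP; split=> // y py.
by rewrite xn; apply: nmax; apply/asboolP; exists y.
Qed.

Lemma longest_parabolic (J : {set I}) : finite_type D J -> parabolic J (longest D J).
Proof. by move=> /longestP/is_longestP[]. Qed.

Lemma is_longest_negative (J : {set I}) (x : W) j : is_longest J x -> j \in J ->
  root_cone J (- act x (alpha j)).
Proof.
move=> /is_longestP[px xmax] jJ; apply: root_negative => //; apply: xmax.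
by apply: gen_mul => //; exact: parabolic_s.
Qed.

Lemma is_longest_inv (J : {set I}) (x : W) : is_longest J x -> is_longest J x^-1%g.
Proof.
move=> /is_longestP[px xmax]; apply/is_longestP; split; first exact: gen_inv.
by move=> y py; rewrite wlen_inv //; exact: xmax.
Qed.

(** The inverse of [w_J] also makes the simple roots of [J] negative, so [w_J^-1 x]
    makes them positive and is the identity. *)
Lemma negative_longest (J : {set I}) (x : W) : finite_type D J -> parabolic J x ->
  (forall j, j \in J -> root_cone J (- act x (alpha j))) -> x = longest D J.
Proof.
move=> fJ px neg; have lw := longestP fJ; have pw := longest_parabolic fJ.
apply: (mulgI (longest D J)^-1%g); rewrite mulVg; apply: (@cone_preserving_eq1 J).
  by apply: gen_mul => //; exact: gen_inv.
move=> j jJ; rewrite actM -[act x _]opprK linearN.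
apply: act_root_cone; last exact: neg.
by move=> k kJ; apply: is_longest_negative => //; exact: is_longest_inv.
Qed.

Lemma longestV (J : {set I}) : finite_type D J -> (longest D J)^-1%g = longest D J.
Proof.
move=> fJ; apply: negative_longest => //; first exact/gen_inv/longest_parabolic.
by move=> j jJ; apply: is_longest_negative => //; apply/is_longest_inv/longestP.
Qed.

Lemma longest_mul (J : {set I}) : finite_type D J -> (longest D J * longest D J = 1)%g.
Proof. by move=> fJ; rewrite -{1}longestV // mulVg. Qed.

Lemma longestK (J : {set I}) l : finite_type D J ->
  act (longest D J) (act (longest D J) l) = l.
Proof. by move=> fJ; rewrite -actM longest_mul // act1. Qed.

Lemma conj_reflection (x : W) j k : act x (alpha j) = - alpha k ->
  (x * s j * x^-1)%g = s k.
Proof.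
move=> e; apply: act_inj => l; rewrite !actM act_s linearB linearZ /= actKV e act_s.
have ejk : rd_form (alpha j) (alpha j) = rd_form (alpha k) (alpha k).
  by rewrite -(rform_act x) e rformNl rformNr opprK.
have := coroot_act x^-1%g l j; rewrite invgK e rformNr mulrN -coroot_form.
rewrite ejk -mulNr => /(mulIf (rform_root_neq0 D k)) ->.
by rewrite scalerN scaleNr opprK.
Qed.

(** The matrix of [- w_J] on the simple roots of [J] has natural number entries and
    its square is the identity; such a matrix is a permutation matrix. *)
Lemma longest_permutes (J : {set I}) j : finite_type D J -> j \in J ->
  exists2 k, k \in J & act (longest D J) (alpha j) = - alpha k.
Proof.
move=> fJ jJ; set w := longest D J.
have neg i : i \in J -> root_cone J (- act w (alpha i)).
  by move=> iJ; apply: is_longest_negative => //; exact: longestP.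
pose n i : I -> nat := if pselect (i \in J) is left iJ then s2val (cid2 (neg i iJ)) else fun=> 0%N.
have nE i : i \in J -> act w (alpha i) = - \sum_k alpha k *+ n i k.
  by move=> iJ; rewrite /n; case: pselect => // iJ'; case: cid2 => /= m _ <-; rewrite opprK.
have n0 i k : k \notin J -> n i k = 0%N.
  by rewrite /n; case: pselect => // iJ; case: cid2 => /= m m0 _ /m0.
(* The square of the matrix [n] is the identity. *)
have prod1 i : i \in J -> forall l, (\sum_k n i k * n k l)%N = (l == i).
  move=> iJ l; apply: (root_nat_inj (D := D)
    (m := fun l => (\sum_k n i k * n k l)%N) (n := fun l => (l == i) : nat)).
  transitivity (alpha i); last first.
    by rewrite (bigD1 i) //= eqxx big1 ?addr0 // => k /negPf ->.
  rewrite -(longestK (alpha i) fJ) -/w nE // linearN linear_sum -sumrN /=.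
  transitivity (\sum_k \sum_l (alpha l *+ n k l) *+ n i k).
    rewrite exchange_big; apply: eq_bigr => m _ /=.
    rewrite -sumrMnr; apply: eq_bigr => k _.
    by rewrite -mulrnA mulnC.
  apply: eq_bigr => k _; rewrite raddfMn -mulNrn /=.
  have [kJ|kJ] := boolP (k \in J); last by rewrite n0 // !mulr0n sumrMnl mulr0n.
  by rewrite nE // opprK sumrMnl.
(* Any nonzero entry of row [j] will do: it forces row [k] to be supported at [j]. *)
have [k nk] : exists k, (0 < n j k)%N.
  apply: contrapT => /forallNP h0; have := prod1 j jJ j.
  rewrite eqxx big1 // => k _; move/negP: (h0 k); rewrite -eqn0Ngt => /eqP ->.
  by rewrite mul0n.
have kJ : k \in J by apply: contraTT nk => /n0 ->.
have nk0 l : l != j -> n k l = 0%N.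
  move=> lj; have /eqP := prod1 j jJ l; rewrite (negPf lj) sum_nat_eq0 => /forallP/(_ k) /=.
  by rewrite muln_eq0 => /orP[/eqP e|/eqP//]; rewrite e in nk.
have nkj : n k j = 1%N.
  have := prod1 k kJ k; rewrite eqxx (bigD1 j) //= big1 ?addn0; last first.
    by move=> l lj; rewrite nk0.
  by move=> /eqP; rewrite muln_eq1 => /andP[/eqP].
exists k => //.
rewrite -[alpha j]opprK linearN; congr (- _).
rewrite -[RHS](longestK _ fJ) -/w nE // (bigD1 j) //= nkj big1 ?addr0 // => l lj.
by rewrite nk0.
Qed.

Lemma starP (J : {set I}) j : finite_type D J -> j \in J ->
  [/\ star D J j \in J, act (longest D J) (alpha j) = - alpha (star D J j) &
      (longest D J * s j * longest D J)%g = s (star D J j)].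
Proof.
move=> fJ jJ; have [k kJ e] := longest_permutes fJ jJ.
have ek : (longest D J * s j * longest D J)%g = s k.
  by rewrite -(conj_reflection e) longestV.
suff -> : star D J j = k by [].
rewrite /star; case: xgetP => [m _ [mJ em]|/(_ k)[]//].
by apply: (@s_inj _ _ D); rewrite em ek.
Qed.

(** In [s_j s_k alpha_j = s_k s_j alpha_j] the coefficients of [alpha_k] are
    opposite to each other. *)
Lemma orthogonal_cartan (J K : {set I}) j k : Defs.orthogonal D J K -> j \in J -> k \in K ->
  alpha j (coroot k) = 0.
Proof.
move=> [djk com] jJ kK.
have njk : j != k.
  by apply: contraTneq kK => <-; rewrite (disjointFr djk jJ).
have := com j k jJ kK => /(congr1 (fun x => act x (alpha j))).
rewrite !actM act_s_root linearN !(act_s k) linearB linearZ /= act_s_root (act_s j).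
set b := alpha j (coroot k).
move=> e.
have : \sum_i ((i == k)%:R * (- b *+ 2) + (i == j)%:R * (b * alpha k (coroot j))) *:
    alpha i = \sum_i (fun=> 0) i *: alpha i.
  rewrite [RHS]big1; last by move=> i _; rewrite scale0r.
  under eq_bigr do rewrite scalerDl.
  rewrite big_split /= !root_delta_sum.
  move/eqP: e; rewrite -subr_eq0 => /eqP <-.
  rewrite scalerBr scalerA !opprB opprK mulr2n scalerDl !scaleNr -!addrA.
  rewrite (act_s k (alpha j)) -/b.  rewrite (addrCA (- (b *: alpha k)) (alpha j)).
  rewrite (addrCA ((b * alpha k (coroot j)) *: alpha j) (alpha j)) addKr.
  by rewrite [RHS]addrC -addrA.
move=> /root_coeff_inj/(_ k); rewrite eqxx eq_sym (negPf njk) mul0r mul1r addr0.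
by move=> /eqP; rewrite mulrn_eq0 oppr_eq0 /= => /eqP.
Qed.

Lemma parabolic_fix (K : {set I}) (x : W) (l : h') : parabolic K x ->
  (forall k, k \in K -> l (coroot k) = 0) -> act x l = l.
Proof.
move=> /parabolicP[u [uK <-]] l0.
elim: u uK => [|k u IH] /=; first by rewrite wp_nil act1.
case/andP=> kK /IH e; rewrite wp_cons actM e act_s l0 // scale0r subr0 //.
Qed.

Lemma parabolic_sub (J K : {set I}) (x : W) : J \subset K -> parabolic J x -> parabolic K x.
Proof.
move=> /fintype.subsetP JK /parabolicP[u [uJ <-]]; apply: parabolic_word.
by apply: sub_all uJ => j; exact: JK.
Qed.

Lemma orthogonal_sym (J K : {set I}) : Defs.orthogonal D J K -> Defs.orthogonal D K J.
Proof.
case=> d c; split=> [|k j kK jJ]; first by rewrite disjoint_sym.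
by rewrite (c _ _ jJ kK).
Qed.

(** Each factor fixes the simple roots of the other one, so the product makes the
    simple roots of both sets negative. *)
Lemma longest_orthogonal (J J' J'' : {set I}) :
  finite_type D J -> finite_type D J' -> finite_type D J'' ->
  J = J' :|: J'' -> Defs.orthogonal D J' J'' ->
  longest D J = (longest D J' * longest D J'')%g.
Proof.
move=> fJ fJ' fJ'' eJ orth.
have s' : J' \subset J by rewrite eJ finset.subsetUl.
have s'' : J'' \subset J by rewrite eJ finset.subsetUr.
apply/esym/negative_longest => //.
  by apply: gen_mul; [move: s'|move: s'']; move/parabolic_sub; apply; exact: longest_parabolic.
move=> j; rewrite {1}eJ inE actM => /orP[] jJ.
  rewrite (parabolic_fix (longest_parabolic fJ'')); last first.
    by move=> k kJ; exact: orthogonal_cartan jJ kJ.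
  by apply: root_cone_sub s' _; apply: is_longest_negative => //; exact: longestP.
have [k kJ ->] := longest_permutes fJ'' jJ; rewrite linearN opprK.
rewrite /= (parabolic_fix (longest_parabolic fJ')); last first.
  by move=> i iJ; exact: orthogonal_cartan (orthogonal_sym orth) kJ iJ.
exact: root_cone_root (fintype.subsetP s'' _ kJ).
Qed.

(** The conjugate of [w_K] by [w_J] lies in the parabolic subgroup of [star K] and makes
    its simple roots negative, because [w_J] exchanges [alpha_k] and
    [- alpha_(star k)]. *)
Lemma longest_star (J K K' : {set I}) :
  finite_type D J -> finite_type D K -> finite_type D K' ->
  K \subset J -> K' = star D J @: K ->
  (longest D J * longest D K = longest D K' * longest D J)%g.
Proof.
move=> fJ fK fK' sKJ eK'.
have KJ k : k \in K -> k \in J by apply: (fintype.subsetP sKJ).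
suff <- : (longest D J * longest D K * longest D J)%g = longest D K'.
  by rewrite -mulgA longest_mul // mulg1.
apply: negative_longest => //.
  have /parabolicP[u [uK <-]] := longest_parabolic fK.
  elim: u uK => [|k u IH] /=.
    by rewrite wp_nil mulg1 longest_mul // => _; exact: gen_one.
  case/andP=> kK /IH pu.
  have -> : (longest D J * wp (k :: u) * longest D J =
     longest D J * s k * longest D J * (longest D J * wp u * longest D J))%g.
    by rewrite wp_cons -!mulgA (mulgA (longest D J) (longest D J)) longest_mul // mul1g.
  have [_ _ ->] := starP fJ (KJ k kK).
  by apply: gen_mul => //; apply: parabolic_s; rewrite eK' imset_f.
move=> k'; rewrite eK' => /imsetP[k kK ->{k'}].
have [_ e _] := starP fJ (KJ k kK).
rewrite !actM -[alpha (star D J k)]opprK -e linearN /= longestK // !linearN /= !linearN /= opprK.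
have [i iK ->] := longest_permutes fK kK.
have [_ ei _] := starP fJ (KJ i iK).
rewrite linearN /= ei opprK; apply: root_cone_root.
by rewrite imset_f.
Qed.

Lemma finite_type1 i : finite_type D [set i].
Proof.
rewrite /finite_type cards1; apply/asboolP.
apply: (@sub_finite_set _ _ [set` [:: 1%g; s i]]); last exact: finite_seq.
move=> x; elim=> {x} [|x [j ji <-]|x y _ hx _ hy|x _ hx] /=.
- by rewrite !inE eqxx.
- by move: ji; rewrite /= inE => /eqP ->; rewrite !inE eqxx orbT.
- move: hx hy; rewrite /= !inE => /orP[] /eqP -> /orP[] /eqP ->.
  + by rewrite mul1g eqxx.
  + by rewrite mul1g eqxx orbT.
  + by rewrite mulg1 eqxx orbT.
  + by rewrite mulss eqxx.
- move: hx; rewrite /= !inE => /orP[] /eqP ->; first by rewrite invg1 eqxx.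
  by rewrite invs eqxx orbT.
Qed.

Lemma longest1 i : longest D [set i] = s i.
Proof.
apply/esym/negative_longest; first exact: finite_type1.
  by apply: parabolic_s; rewrite inE.
move=> j; rewrite inE => /eqP ->; rewrite act_s_root opprK.
by apply: root_cone_root; rewrite inE.
Qed.

Lemma cactus_to_weyl : exists psi : {multiplicative cactus D -> W},
  forall J, psi (tau J) = longest D (val J).
Proof.
apply: presented_extend => u v; case=> [J|J J' J'' eJ orth|J K K' KJ eK].
- by rewrite !big_cons !big_nil mulg1 longest_mul //; exact: (valP J).
- rewrite !big_cons !big_nil !mulg1; apply: longest_orthogonal => //.
  + exact: (valP J).
  + exact: (valP J').
  + exact: (valP J'').
- rewrite !big_cons !big_nil !mulg1; apply: longest_star => //.
  + exact: (valP J).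
  + exact: (valP K).
  + exact: (valP K').
Qed.

End Longest.

(** * Quantum integers and sl2 commutation formulas *)

Section QuantumNumbers.
Variables (k : fieldType) (u : k).
Hypothesis u0 : u != 0.
Hypothesis u_nroot : forall n, (0 < n)%N -> u ^+ n != 1.

Lemma qdiff_neq0 : u - u^-1 != 0.
Proof.
rewrite subr_eq0; apply: contra (u_nroot (isT : 0 < 2)%N) => /eqP e.
by rewrite expr2 {1}e mulVf.
Qed.

Lemma qint_neq0 n : (0 < n)%N -> qint u n != 0.
Proof.
move=> n0; rewrite /qint mulf_neq0 ?invr_neq0 ?qdiff_neq0 // subr_eq0.
apply: contra (u_nroot (n := n * 2) _); last by rewrite muln_gt0 n0.
by move=> /eqP e; rewrite exprM expr2 {1}e mulVf // expf_neq0.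
Qed.

Lemma qfact0 : qfact u 0 = 1.
Proof. by rewrite /qfact big_nil. Qed.

Lemma qfactS n : qfact u n.+1 = qfact u n * qint u n.+1.
Proof. by rewrite /qfact big_nat_recr. Qed.

Lemma qfact_neq0 n : qfact u n != 0.
Proof.
elim: n => [|n IH]; first by rewrite qfact0 oner_neq0.
by rewrite qfactS mulf_neq0 // qint_neq0.
Qed.

Lemma qint_subtraction n m :
  qint u (n + m) * u ^+ n - qint u n * u ^+ (n + m) = qint u m.
Proof.
rewrite /qint exprD; have := qdiff_neq0.
have: u ^+ n != 0 by rewrite expf_neq0.
have: u ^+ m != 0 by rewrite expf_neq0.
move: (u ^+ n) (u ^+ m) (u - u^-1) => x y z y0 x0 z0.
by field; rewrite ?z0 ?x0 ?y0.
Qed.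

(** Up to the factor [[N+1]!] the summands are
    [(-1)^r u^(N (N+1-r)) [N+1 choose r]]; by the quantum Pascal rule the sum
    telescopes, and its partial sums are single terms. *)
Lemma alternating_qbinomial_partial N m : (m <= N)%N ->
  \sum_(r < m.+1) (-1) ^+ r * u ^+ (N * (N.+1 - r)) / (qfact u r * qfact u (N.+1 - r)) =
  (-1) ^+ m * u ^+ (N.+1 * (N - m)) / (qfact u m * qfact u (N - m) * qint u N.+1).
Proof.
elim: m => [|m IH] mN.
  rewrite big_ord1 !expr0 !subn0 !mul1r qfact0 !mul1r qfactS.
  by rewrite mulnC.
rewrite big_ord_recr /= IH ?(ltnW mN) //.
have [M eN] : exists M, N = (m.+1 + M)%N by exists (N - m.+1)%N; rewrite subnKC.
have -> : (N.+1 - m.+1 = M.+1)%N by lia.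
have -> : (N - m = M.+1)%N by lia.
have -> : (N - m.+1 = M)%N by lia.
rewrite (qfactS m) (qfactS M).
have := @qint_subtraction m.+1 M.+1.
have -> : (m.+1 + M.+1 = N.+1)%N by lia.
have q1 : qint u m.+1 != 0 by apply: qint_neq0.
have q2 : qint u M.+1 != 0 by apply: qint_neq0.
have q3 : qint u N.+1 != 0 by apply: qint_neq0.
have f1 := qfact_neq0 m; have f2 := qfact_neq0 M.
have -> : (N * M.+1 = N.+1 * M + m.+1)%N by rewrite eN; ring.
have -> : (N.+1 * M.+1 = N.+1 * M + N.+1)%N by ring.
rewrite !exprD (exprS (-1)) mulN1r.
move: (u ^+ (N.+1 * M)) (u ^+ m.+1) (u ^+ N.+1) (qint u m.+1) (qint u M.+1)
  (qint u N.+1) (qfact u m) (qfact u M) ((-1) ^+ m) q1 q2 q3 f1 f2.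
move=> A x y p q s f g e q1 q2 q3 f1 f2 eq; rewrite -eq in q2 *.
by field; rewrite ?q1 ?q2 ?q3 ?f1 ?f2.
Qed.

Lemma alternating_qbinomial N :
  \sum_(r < N.+2) (-1) ^+ r * u ^+ (N * (N.+1 - r)) / (qfact u r * qfact u (N.+1 - r)) = 0.
Proof.
rewrite big_ord_recr /= alternating_qbinomial_partial // !subnn !muln0 !expr0.
by rewrite qfact0 !mulr1 qfactS exprS mulN1r mulNr subrr.
Qed.

Variables (V : lmodType k) (E F K K' : {linear V -> V}).
Let c := (u - u^-1)^-1.

Lemma iter_linear n a x y : iter n F (a *: x + y) = a *: iter n F x + iter n F y.
Proof. by elim: n => //= n ->; rewrite linearP. Qed.
Lemma iter_linearZ n a x : iter n F (a *: x) = a *: iter n F x.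
Proof. by elim: n => //= n ->; rewrite linearZ. Qed.
Lemma iter_linearD n x y : iter n F (x + y) = iter n F x + iter n F y.
Proof. by elim: n => //= n ->; rewrite linearD. Qed.
Lemma iter_linear0 n : iter n F 0 = 0.
Proof. by elim: n => //= n ->; rewrite linear0. Qed.

Lemma divided_power0 x : divided_power u F 0 x = x.
Proof. by rewrite /divided_power qfact0 invr1 scale1r. Qed.
Lemma divided_powerD n x y :
  divided_power u F n (x + y) = divided_power u F n x + divided_power u F n y.
Proof. by rewrite /divided_power iter_linearD scalerDr. Qed.
Lemma divided_powerZ n a x : divided_power u F n (a *: x) = a *: divided_power u F n x.
Proof. by rewrite /divided_power iter_linearZ !scalerA mulrC. Qed.
Lemma divided_power_comp m n x :
  divided_power u F m (divided_power u F n x) =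
  (qfact u m * qfact u n)^-1 *: iter (m + n) F x.
Proof. by rewrite /divided_power iter_linearZ scalerA iterD invfM. Qed.

Lemma divided_power_commute (G : {linear V -> V}) (a : k) n x :
  (forall x, G (F x) = a *: F (G x)) ->
  G (divided_power u F n x) = a ^+ n *: divided_power u F n (G x).
Proof.
move=> GF; rewrite /divided_power linearZ scalerA mulrC -scalerA; congr (_ *: _).
elim: n => [|n IH] /=; first by rewrite scale1r.
by rewrite GF IH linearZ scalerA exprS.
Qed.

Hypothesis EF : forall x, E (F x) - F (E x) = c *: (K x - K' x).
Hypothesis KF : forall x, K (F x) = u ^- 2 *: F (K x).
Hypothesis K'F : forall x, K' (F x) = u ^+ 2 *: F (K' x).

(** [E] is moved through [F^(n+1)] one factor at a time; the commutators form a
    geometric sum, which is the quantum integer. *)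
Lemma sl2_iter n x :
  E (iter n.+1 F x) = iter n.+1 F (E x) +
    (qint u n.+1 * c) *: iter n F (u ^- n *: K x - u ^+ n *: K' x).
Proof.
have EF' y : E (F y) = F (E y) + c *: (K y - K' y) by rewrite -EF addrCA subrr addr0.
have q1 : qint u 1 = 1 by rewrite /qint divff // qdiff_neq0.
elim: n x => [|n IH] x.
  by rewrite /= q1 mul1r expr0 invr1 !scale1r EF'.
rewrite iterSr IH EF' iter_linearD -iterSr -addrA; congr (_ + _).
rewrite KF K'F !scalerA -!scaleNr -(scaleN1r (K' x)) !iter_linearD !iter_linearZ.
rewrite -iterSr -[iter n F (F (K' x))]iterSr.
rewrite !iter_linearD iter_linearZ !scalerDr !scalerA addrACA -!scalerDl.
have un0 : u ^+ n != 0 by rewrite expf_neq0.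
have z1 : u ^+ 2 - 1 != 0 by rewrite subr_eq0 u_nroot.
congr (_ *: _ + _ *: _); rewrite /c /qint !exprS; move: (u ^+ n) un0 => y y0.
  by field; rewrite y0 u0 z1.
by field; rewrite y0 u0 z1.
Qed.

Lemma sl2_divided_power n x :
  E (divided_power u F n.+1 x) = divided_power u F n.+1 (E x) +
    c *: divided_power u F n (u ^- n *: K x - u ^+ n *: K' x).
Proof.
rewrite /divided_power linearZ /= -[F (iter n F x)]/(iter n.+1 F x) sl2_iter scalerDr.
congr (_ + _); rewrite !scalerA; congr (_ *: _).
rewrite qfactS; have := qfact_neq0 n; have : qint u n.+1 != 0 by apply: qint_neq0.
by move: (qfact u n) (qint u n.+1) c => f q d q0 f0; field; rewrite f0 q0.
Qed.
End QuantumNumbers.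

(** * Serre expressions commute with the opposite generators *)

Section SerreCommutes.
Variables (k : fieldType) (I : finType) (V : lmodType k).
Variables (E F K K' : I -> {linear V -> V}) (q : I -> k) (a : I -> I -> int).
Hypothesis q0 : forall i, q i != 0.
Hypothesis q_nroot : forall i n, (0 < n)%N -> q i ^+ n != 1.
Hypothesis EF : forall i j x, E i (F j x) - F j (E i x) =
  if i == j then (q i - (q i)^-1)^-1 *: (K i x - K' i x) else 0.
Hypothesis KF : forall i j x, K i (F j x) = q i ^ (- a i j) *: F j (K i x).
Hypothesis K'F : forall i j x, K' i (F j x) = q i ^ (a i j) *: F j (K' i x).
Hypothesis a_diag : forall i, a i i = 2.
Hypothesis q_sym : forall i j, q i ^ a i j = q j ^ a j i.

Definition serre (i j : I) (N : nat) (x : V) : V :=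
  \sum_(r < N.+1) (-1) ^+ r *:
    divided_power (q i) (F i) r (F j (divided_power (q i) (F i) (N - r)%N x)).

Local Notation dp i := (divided_power (q i) (F i)).
Local Notation c i := ((q i - (q i)^-1)^-1).

Lemma serre_linear i j N c x y : serre i j N (c *: x + y) = c *: serre i j N x + serre i j N y.
Proof.
rewrite /serre scaler_sumr -big_split; apply: eq_bigr => r _ /=.
rewrite divided_powerD divided_powerZ linearD [F j (c *: _)]linearZ divided_powerD.
rewrite divided_powerZ scalerDr; congr (_ + _).
by rewrite [LHS]scalerA mulrC -[LHS]scalerA.
Qed.

Let EFC i j x : i != j -> E i (F j x) = F j (E i x).
Proof. by move=> ne; apply/eqP; rewrite -subr_eq0 EF (negPf ne). Qed.
Let EFD i x : E i (F i x) = F i (E i x) + c i *: (K i x - K' i x).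
Proof. by have := EF i i x; rewrite eqxx => <-; rewrite addrCA subrr addr0. Qed.

Let E_dp m i n x : m != i -> E m (dp i n x) = dp i n (E m x).
Proof.
move=> ne; rewrite (@divided_power_commute _ _ _ _ _ 1) ?expr1n ?scale1r //.
by move=> y; rewrite scale1r EFC.
Qed.

Let E_dp_diag i n x : E i (dp i n.+1 x) = dp i n.+1 (E i x) +
    c i *: dp i n (q i ^- n *: K i x - q i ^+ n *: K' i x).
Proof.
apply: sl2_divided_power => //; first exact: q_nroot.
- by move=> y; have := EF i i y; rewrite eqxx.
- by move=> y; rewrite KF a_diag.
- by move=> y; rewrite K'F a_diag.
Qed.

Let K_dp m i n x : K m (dp i n x) = q m ^ (- a m i * n%:Z) *: dp i n (K m x).
Proof.
rewrite (@divided_power_commute _ _ _ _ _ (q m ^ (- a m i))) //.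
by rewrite exprnP exprz_exp.
Qed.
Let K'_dp m i n x : K' m (dp i n x) = q m ^ (a m i * n%:Z) *: dp i n (K' m x).
Proof.
rewrite (@divided_power_commute _ _ _ _ _ (q m ^ (a m i))) //.
by rewrite exprnP exprz_exp.
Qed.

Variables (i j : I) (N : nat).
Hypothesis nij : i != j.
Hypothesis aN : a i j = - N%:Z.

Let serre_other m x : m != i -> m != j -> E m (serre i j N.+1 x) = serre i j N.+1 (E m x).
Proof.
move=> mi mj; rewrite /serre linear_sum; apply: eq_bigr => r _ /=.
by rewrite linearZ /= E_dp // EFC // E_dp.
Qed.

Let qint_inv n : qint (q i)^-1 n = qint (q i) n.
Proof.
rewrite /qint invrK exprVn invrK -[in RHS]opprB -[X in _ / X = _]opprB.
by rewrite invrN mulrN mulNr.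
Qed.
Let qfact_inv n : qfact (q i)^-1 n = qfact (q i) n.
Proof. by apply: eq_bigr => m _; exact: qint_inv. Qed.

(** Moving [K_j] to the right leaves a multiple of [F_i^(N+1) K_j], whose coefficient
    is the alternating sum of [alternating_qbinomial]; likewise for its inverse,
    with [q_i] replaced by [q_i^-1]. *)
Let serre_second x : E j (serre i j N.+1 x) = serre i j N.+1 (E j x).
Proof.
have nji : j != i by rewrite eq_sym.
have qj : q j ^ a j i = q i ^ (- N%:Z) by rewrite -q_sym aN.
have Kji n y : K j (dp i n y) = q i ^+ (N * n) *: dp i n (K j y).
  by rewrite K_dp -exprz_exp -invr_expz qj invr_expz opprK exprz_exp.
have K'ji n y : K' j (dp i n y) = (q i)^-1 ^+ (N * n) *: dp i n (K' j y).
  by rewrite K'_dp -exprz_exp qj exprz_exp mulNr -exprz_inv.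
have collapse (u : k) (y : V) : (forall n, qfact u n = qfact (q i) n) ->
    \sum_(r < N.+2) (-1) ^+ r * u ^+ (N * (N.+1 - r)) /
      (qfact u r * qfact u (N.+1 - r)) = 0 ->
    \sum_(r < N.+2) (-1) ^+ r *: dp i r (u ^+ (N * (N.+1 - r)) *: dp i (N.+1 - r) y) = 0.
  move=> uq su; rewrite -[RHS](scale0r (iter N.+1 (F i) y)) -su scaler_suml.
  apply: eq_bigr => r _; rewrite divided_powerZ divided_power_comp !scalerA !uq.
  by rewrite subnKC // -ltnS.
apply/eqP; rewrite -subr_eq0 /serre linear_sum -sumrB /=; apply/eqP.
transitivity (c j *: (
  \sum_(r < N.+2) (-1) ^+ r *: dp i r (q i ^+ (N * (N.+1 - r)) *: dp i (N.+1 - r) (K j x)) -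
  \sum_(r < N.+2) (-1) ^+ r *: dp i r ((q i)^-1 ^+ (N * (N.+1 - r)) *: dp i (N.+1 - r) (K' j x)))).
  rewrite -sumrB scaler_sumr; apply: eq_bigr => r _.
  rewrite linearZ /= -scalerBr E_dp // EFD E_dp // divided_powerD addrAC subrr add0r.
  rewrite Kji K'ji divided_powerZ -[- (_ *: _)]scaleN1r divided_powerD.
  rewrite [dp i r (-1 *: _)]divided_powerZ.
  rewrite scaleN1r; set X := dp i r _; set Y := dp i r _.
  by move: X Y => X Y; rewrite -scalerBr !scalerA mulrC.
have vanish := collapse _ (K j x) (fun=> erefl) (alternating_qbinomial (q0 i) (@q_nroot i) N).
have vanish' : \sum_(r < N.+2) (-1) ^+ r *:
    dp i r ((q i)^-1 ^+ (N * (N.+1 - r)) *: dp i (N.+1 - r) (K' j x)) = 0.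
  apply: collapse qfact_inv _; apply: alternating_qbinomial => [|n n0].
    by rewrite invr_eq0.
  by rewrite exprVn invr_eq1 q_nroot.
by rewrite vanish vanish' subrr scaler0.
Qed.

(** [E_i] produces commutators with the divided powers on both sides of [F_j]. Those
    on the left at index [r+1] and those on the right at index [r] are equal, and
    they carry opposite signs. *)
Let serre_first x : E i (serre i j N.+1 x) = serre i j N.+1 (E i x).
Proof.
pose G (r : nat) : V := c i *: dp i r (F j (dp i (N - r)
   (q i ^- (N - r) *: K i x - q i ^+ (N - r) *: K' i x))).
(* [A r] and [B r] are the commutators with the left and the right divided power. *)
pose A (r : nat) : V := if r is r'.+1 then G r' else 0.
pose B (r : nat) : V := if (r <= N)%N then G r else 0.
have middle (r M : nat) : (r + M = N)%N ->
    q i ^- r *: K i (F j (dp i M x)) - q i ^+ r *: K' i (F j (dp i M x)) =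
    F j (dp i M (q i ^- M *: K i x - q i ^+ M *: K' i x)).
  move=> rM; rewrite KF K'F aN opprK K_dp K'_dp a_diag -!scaleNr divided_powerD !divided_powerZ.
  rewrite !linearD !linearZ /= !scalerA.
  have qM : q i ^+ M != 0 by rewrite expf_neq0.
  have qr : q i ^+ r != 0 by rewrite expf_neq0.
  have e2 : q i ^ (2 * M%:Z) = q i ^+ M * q i ^+ M by rewrite -exprD exprnP; congr (_ ^ _); lia.
  rewrite mulNr -!invr_expz e2 -exprnP -rM exprD.
  have f0 : qfact (q i) M != 0 by apply: qfact_neq0 => // n; exact: q_nroot.
  congr (_ *: _ + _ *: _); move: (q i ^+ M) (q i ^+ r) (qfact _ _) qM qr f0 => y z f y0 z0 f0.
    by field; rewrite y0 z0 f0.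
  by field; rewrite y0 z0 f0.
have outer (r : nat) : (r <= N)%N -> E i (F j (dp i (N.+1 - r) x)) =
    F j (dp i (N.+1 - r) (E i x)) + c i *: F j (dp i (N - r)
      (q i ^- (N - r) *: K i x - q i ^+ (N - r) *: K' i x)).
  by move=> rN; rewrite EFC // subSn // E_dp_diag linearD [F j (c i *: _)]linearZ.
have step (r : nat) : (r <= N.+1)%N -> E i (dp i r (F j (dp i (N.+1 - r) x))) =
    dp i r (F j (dp i (N.+1 - r) (E i x))) + A r + B r.
  case: r => [_|r rN]; first by rewrite /A !divided_power0 outer // addr0 /B /G !divided_power0.
  rewrite E_dp_diag middle ?subnKC // /A -/(G r) [in RHS]addrAC subSS; congr (_ + _).
  rewrite /B; case: ltnP => [rltN|Nr].
    have -> : (N - r = N.+1 - r.+1)%N by [].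
    by rewrite outer // divided_powerD divided_powerZ.
  have -> : (N - r = 0)%N by lia.
  by rewrite !divided_power0 addr0 (EFC x nij).
rewrite /serre linear_sum.
transitivity (\sum_(r < N.+2) ((-1) ^+ r *: dp i r (F j (dp i (N.+1 - r) (E i x))) +
   ((-1) ^+ r *: A r + (-1) ^+ r *: B r))).
  apply: eq_bigr => r _; rewrite linearZ /= step; last by rewrite -ltnS.
  by rewrite -addrA !scalerDr.
rewrite big_split /= -[RHS]addr0; congr (_ + _).
rewrite big_split /= big_ord_recl [X in _ + X]big_ord_recr /=.
rewrite scaler0 add0r {2}/B ltnn scaler0 addr0 -big_split big1 // => r _ /=.
by rewrite /bump /= add1n /B -ltnS ltn_ord exprS mulN1r scaleNr addNr.
Qed.

(** This holds in any module over the algebra without Serre relations; [K] and [K']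
    stand for [K_(alpha_i)] and its inverse, and the hypotheses allow [E] and [F] to
    be exchanged if [K] and [K'] are exchanged as well. *)
Lemma serre_commute m x : E m (serre i j N.+1 x) = serre i j N.+1 (E m x).
Proof.
have [->|mi] := eqVneq m i; first exact: serre_first.
have [->|mj] := eqVneq m j; first exact: serre_second.
exact: serre_other.
Qed.
End SerreCommutes.

(** * Powers of q and weight vectors *)

Section QPowers.
Variables (R : realType) (I : finType) (D : root_datum R I) (k : fieldType) (t : k).
Hypothesis t0 : t != 0.
Hypothesis t_nroot : forall n, (0 < n)%N -> t ^+ n != 1.

Local Notation h := (rd_h D).
Local Notation h' := 'Hom(h, R[i]^o).
Local Notation alpha := (rd_root D).
Local Notation coroot := (rd_coroot D).
Local Notation form := (@rd_form _ _ D).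
Local Notation P := (@rd_lattice _ _ D).
Local Notation half := (@half_lattice _ _ D).
Local Notation qp := (qpow D t).
Local Notation q := (q_ D t).
Local Notation C := R[i].

(** At these exponents [qpow] involves no rounding, so it is additive. *)
Definition q_integral (c : C) : Prop := exists z : int, c * (2 * rd_d D)%:R = z%:~R.

Lemma Re_intr (z : int) : complex.Re (z%:~R : C) = z%:~R.
Proof. by rewrite -(rmorph_int (real_complex R)). Qed.

Lemma qpowE c z : c * (2 * rd_d D)%:R = z%:~R -> qp c = t ^ z.
Proof. by move=> e; rewrite /qpow e Re_intr intrKfloor. Qed.

Lemma scale_neq0 : (2 * rd_d D)%:R != 0 :> C.
Proof. by rewrite pnatr_eq0 muln_eq0 -lt0n (rd_d_gt0 D). Qed.

Lemma qpowD c e : q_integral c -> q_integral e -> qp (c + e) = qp c * qp e.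
Proof.
move=> [y hy] [z hz]; rewrite (qpowE hy) (qpowE hz) (@qpowE _ (y + z)).
  by rewrite expfzDr.
by rewrite mulrDl hy hz intrD.
Qed.

Lemma q_integralN c : q_integral c -> q_integral (- c).
Proof. by move=> [z hz]; exists (- z); rewrite mulNr hz mulrNz. Qed.
Lemma q_integralD c e : q_integral c -> q_integral e -> q_integral (c + e).
Proof. by move=> [y hy] [z hz]; exists (y + z); rewrite mulrDl hy hz intrD. Qed.
Lemma q_integralB c e : q_integral c -> q_integral e -> q_integral (c - e).
Proof. by move=> ? /q_integralN; apply: q_integralD. Qed.

Lemma qpowN c : q_integral c -> qp (- c) = (qp c)^-1.
Proof.
by move=> [z hz]; rewrite (qpowE hz) (@qpowE _ (- z)) ?invr_expz // mulNr hz mulrNz.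
Qed.
Lemma qpowB c e : q_integral c -> q_integral e -> qp (c - e) = qp c / qp e.
Proof. by move=> hc he; rewrite qpowD ?qpowN //; exact: q_integralN. Qed.
Lemma qpow0 : qp 0 = 1.
Proof. by rewrite (@qpowE _ 0) // mul0r. Qed.
Lemma qpow_neq0 c : q_integral c -> qp c != 0.
Proof. by move=> [z hz]; rewrite (qpowE hz) expfz_neq0. Qed.

Lemma exprz_eq1 (z : int) : t ^ z = 1 -> z = 0.
Proof.
case: z => n e; first by case: n e => // n /eqP; rewrite (negPf (t_nroot _)).
by move/eqP: e; rewrite NegzE -invr_expz invr_eq1 (negPf (t_nroot _)).
Qed.

Lemma qpow_eq1 c : q_integral c -> qp c = 1 -> c = 0.
Proof.
move=> [z hz]; rewrite (qpowE hz) => /exprz_eq1 z0; move: hz.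
by rewrite z0 => /eqP; rewrite mulf_eq0 (negPf scale_neq0) orbF => /eqP.
Qed.

Lemma qpow_inj c e : q_integral c -> q_integral e -> qp c = qp e -> c = e.
Proof.
move=> hc he ece; apply/eqP; rewrite -subr_eq0; apply/eqP/qpow_eq1.
  exact: q_integralB.
by rewrite qpowB // ece divff // qpow_neq0.
Qed.

Lemma lattice_half l : P l -> half l.
Proof. by move=> Pl; apply: latticeMn. Qed.

Lemma q_integral_form l m : half l -> P m -> q_integral (form l m).
Proof.
move=> hl Pm; have [z hz] := rd_dP hl Pm; exists z.
have d0 : (rd_d D)%:R != 0 :> C by rewrite pnatr_eq0 -lt0n (rd_d_gt0 D).
by rewrite natrM mulrA [_ * 2%:R]mulr_natr -rformMnl hz divfK.
Qed.

Lemma half_act w l : half l -> half (act w l).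
Proof. by move=> hl; rewrite /half_lattice /= -raddfMn; apply: lattice_act. Qed.

Lemma half_opp l : half l -> half (- l).
Proof. by move=> hl; rewrite /half_lattice /= mulNrn; apply: latticeN. Qed.

Lemma half_root i : half (alpha i).
Proof. exact/lattice_half/rd_root_lattice. Qed.

Lemma qpow_intM c (z : int) : q_integral c -> qp (c * z%:~R) = qp c ^ z.
Proof.
move=> [y hy]; rewrite (qpowE hy) (@qpowE _ (y * z)) ?exprz_exp //.
by rewrite mulrAC hy -intrM.
Qed.

Lemma q_integral_nat n : q_integral n%:R.
Proof. by exists (n * (2 * rd_d D))%N%:Z; rewrite -natrM. Qed.

Lemma half_norm i : exists2 n : nat, (0 < n)%N & form (alpha i) (alpha i) / 2 = n%:R.
Proof.
have [n n0 ->] := rd_form_even D i; exists n => //.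
by rewrite -muln2 natrM mulfK // pnatr_eq0.
Qed.

Lemma q_neq0 i : q i != 0.
Proof. by rewrite /q_; have [n _ ->] := half_norm i; apply/qpow_neq0/q_integral_nat. Qed.

Lemma q_nroot i n : (0 < n)%N -> q i ^+ n != 1.
Proof.
move=> n0; apply/eqP; rewrite /q_; have [m m0 ->] := half_norm i.
rewrite exprnP -qpow_intM; last exact: q_integral_nat.
rewrite -[n%:~R]/(n%:R) -natrM => /(qpow_eq1 (q_integral_nat _)) /eqP.
by rewrite pnatr_eq0 muln_eq0 eqn0Ngt m0 eqn0Ngt n0.
Qed.

Lemma qpow_root i (l : h') (z : int) : l (coroot i) = z%:~R -> qp (form (alpha i) l) = q i ^ z.
Proof.
move=> hz; rewrite rd_form_sym.
have -> : form l (alpha i) = form (alpha i) (alpha i) / 2 * z%:~R.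
  have := coroot_form l i; rewrite hz mulrC => e.
  by rewrite mulrAC e mulrC mulKf // pnatr_eq0.
by rewrite qpow_intM //; have [n _ ->] := half_norm i; exact: q_integral_nat.
Qed.

Lemma qpow_root_root i j : qp (form (alpha i) (alpha j)) = q i ^ rd_cartan D i j.
Proof. by apply: qpow_root; rewrite rd_pairing. Qed.

Lemma q_sym i j : q i ^ rd_cartan D i j = q j ^ rd_cartan D j i.
Proof. by rewrite -!qpow_root_root rd_form_sym. Qed.

(** [t] is not a root of unity, so the pairings of [b - b'] with [P] vanish; [P]
    spans and the form is nondegenerate. *)
Lemma lattice_separation b b' : P b -> P b' ->
  (forall l, P l -> qp (form l b) = qp (form l b')) -> b = b'.
Proof.
move=> Pb Pb' e.
have ef l : P l -> form l b = form l b'.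
  move=> Pl; have hl := lattice_half Pl.
  by apply: qpow_inj (e l Pl); exact: q_integral_form.
apply/eqP; rewrite -subr_eq0; apply/eqP/(@rd_form_nondeg _ _ D) => m.
have [e' be Pe] := lattice_basis D.
rewrite (coord_basis be (memvf m)) rform_sumr big1 // => i _.
by rewrite rformZr -tnth_nth rd_form_sym rformBr ef // subrr mulr0.
Qed.

Section Modules.
Variable V : uq_module D t.

Lemma weight_vector0 b : weight_vector b (0 : V).
Proof. by move=> l hl; rewrite linear0 scaler0. Qed.

Lemma weight_vectorZ b a (v : V) : weight_vector b v -> weight_vector b (a *: v).
Proof. by move=> wv l hl; rewrite linearZ /= wv // !scalerA mulrC. Qed.

Lemma weight_vector_unique b b' (v : V) : P b -> P b' -> v != 0 ->
  weight_vector b v -> weight_vector b' v -> b = b'.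
Proof.
move=> Pb Pb' v0 wb wb'; apply: lattice_separation => // l Pl.
have hl := lattice_half Pl; apply/eqP; rewrite -subr_eq0.
have := wb l hl; rewrite wb' // => /eqP.
by rewrite eq_sym -subr_eq0 -scalerBl scaler_eq0 (negPf v0) orbF.
Qed.

Lemma weight_E b i (v : V) : P b -> weight_vector b v ->
  weight_vector (b + alpha i) (uqE V i v).
Proof.
move=> Pb wv l hl; rewrite uqKE // wv // linearZ /= scalerA; congr (_ *: _).
have h1 : q_integral (form l b) by exact: q_integral_form.
have h2 : q_integral (form l (alpha i)) by exact: q_integral_form hl (rd_root_lattice D i).
by rewrite rformDr (qpowD h1 h2) mulrC.
Qed.

Lemma weight_F b i (v : V) : P b -> weight_vector b v ->
  weight_vector (b - alpha i) (uqF V i v).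
Proof.
move=> Pb wv l hl; rewrite uqKF // wv // linearZ /= scalerA; congr (_ *: _).
have h1 : q_integral (form l b) by exact: q_integral_form.
have h2 : q_integral (form l (alpha i)) by exact: q_integral_form hl (rd_root_lattice D i).
by rewrite rformBr (qpowB h1 h2) (qpowN h2) mulrC.
Qed.

Lemma lattice_sub_root b i n : P b -> P (b - alpha i *+ n).
Proof. by move=> Pb; apply: latticeB => //; apply/latticeMn/rd_root_lattice. Qed.

Lemma weight_iterF b i n (v : V) : P b -> weight_vector b v ->
  weight_vector (b - alpha i *+ n) (iter n (uqF V i) v).
Proof.
move=> Pb wv; elim: n => [|n IH]; first by rewrite mulr0n subr0.
rewrite mulrSr opprD addrA /=; apply: weight_F => //; exact: lattice_sub_root.
Qed.

Lemma uq_sl2_iter i n (v : V) :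
  uqE V i (iter n.+1 (uqF V i) v) = iter n.+1 (uqF V i) (uqE V i v) +
    (qint (q i) n.+1 * (q i - (q i)^-1)^-1) *: iter n (uqF V i)
      (q i ^- n *: uqK V (alpha i) v - q i ^+ n *: uqK V (- alpha i) v).
Proof.
have q2 : qp (form (alpha i) (alpha i)) = q i ^+ 2 by rewrite qpow_root_root cartan_diag.
have dii : q_integral (form (alpha i) (alpha i)).
  exact: q_integral_form (half_root i) (rd_root_lattice D i).
apply: sl2_iter => // [||x|x|x].
- exact: q_neq0.
- exact: q_nroot.
- by rewrite uqEF eqxx.
- by rewrite uqKF ?qpowN ?q2 //; exact: half_root.
- by rewrite uqKF ?rformNl ?opprK ?q2 //; exact/half_opp/half_root.
Qed.

(** Let [n] be the largest exponent with [F_i^n v <> 0]. Applying [E_i] to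
    [F_i^(n+1) v = 0] gives [[n+1] [b (alpha_i^vee) - n] = 0]. *)
Lemma highest_weight_dominant b i (v : V) : locally_nilpotent (uqF V i) ->
  P b -> weight_vector b v -> uqE V i v = 0 -> v != 0 ->
  exists n : nat, b (coroot i) = n%:R.
Proof.
move=> nil Pb wv Ev v0; have [z hz] := rd_lattice_int i Pb.
have [N /eqP FN] := nil v.
have exN : exists N, iter N (uqF V i) v == 0 by exists N.
have [[|n] /eqP F0 nmin] := ex_minnP exN; first by rewrite /= in F0; rewrite F0 eqxx in v0.
exists n; rewrite hz.
have Fn : iter n (uqF V i) v != 0.
  by apply/negP => /nmin; rewrite ltnn.
have := uq_sl2_iter i n v; rewrite F0 Ev linear0 iter_linear0 add0r.
have dib : q_integral (form (alpha i) b) by exact: q_integral_form (half_root i) Pb.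
rewrite (wv _ (half_root i)) (wv _ (half_opp (half_root i))) rformNl qpowN //.
rewrite (qpow_root hz) !scalerA -scalerBl iter_linearZ scalerA => /esym/eqP.
have c0 : qint (q i) n.+1 * (q i - (q i)^-1)^-1 != 0.
  rewrite mulf_neq0 ?invr_eq0 ?(qdiff_neq0 (q_neq0 i) (@q_nroot i)) //.
  exact: (qint_neq0 (q_neq0 i) (@q_nroot i)).
rewrite scaler_eq0 (negPf Fn) orbF mulf_eq0 (negPf c0) /= subr_eq0 => /eqP e.
have e1 : q i ^ (z - n%:Z) = q i ^ (n%:Z - z).
  by rewrite !expfzDr ?q_neq0 // -!invr_expz mulrC -exprnP e.
have e2 : q i ^ ((z - n%:Z) * 2) = 1.
  rewrite -exprz_exp -exprnP expr2 {2}e1 -expfzDr ?q_neq0 //.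
  by rewrite addrC addrA subrK subrr.
have : (z - n%:Z) * 2 = 0.
  case: ((z - n%:Z) * 2) e2 => m; first by case: m => // m /eqP; rewrite (negPf (q_nroot _ _)).
  by rewrite NegzE -invr_expz => /eqP; rewrite invr_eq1 (negPf (q_nroot _ _)).
by move=> zn; have -> : z = n%:Z by lia.
Qed.
End Modules.
End QPowers.

(** * The operators sigma permute weight spaces by longest elements *)

Section SigmaWeights.
Variables (R : realType) (I : finType) (D : root_datum R I) (k : fieldType) (t : k).
Hypothesis t0 : t != 0.
Hypothesis t_nroot : forall n, (0 < n)%N -> t ^+ n != 1.

Local Notation h := (rd_h D).
Local Notation h' := 'Hom(h, R[i]^o).
Local Notation alpha := (rd_root D).
Local Notation coroot := (rd_coroot D).
Local Notation form := (@rd_form _ _ D).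
Local Notation P := (@rd_lattice _ _ D).
Local Notation half := (@half_lattice _ _ D).
Local Notation s := (simple_reflection D).
Local Notation W := (weyl D).
Local Notation wp := (word_prod D).
Local Notation qp := (qpow D t).
Local Notation C := R[i].

Lemma coreflection_pairing (l : h') (x : h) w :
  l (foldl (fun (y : h) j => coreflection j y) x w) = act (wp w) l x.
Proof.
elim: w x => [|j w IH] x /=; first by rewrite wp_nil act1.
rewrite IH wp_cons actM act_s /coreflection linearB linearZ /=.
rewrite add_lfunE opp_lfunE scale_lfunE; congr (_ - _); exact: mulrC.
Qed.

Lemma Re_nat n : complex.Re (n%:R : C) = n%:R.
Proof. exact: (Re_intr R n). Qed.

(** The pairing equals that of [b] with [w^-1 alpha_i^vee], and [w^-1 alpha_i] is
    positive because the word [i :: w] is reduced. This makes the truncated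
    exponents in [F_word] the true ones. *)
Lemma reduced_pairing_nat (J : {set I}) i w (b : h') : reduced_word D J (i :: w) -> P b ->
  (forall j, j \in J -> exists n : nat, b (coroot j) = n%:R) ->
  exists n : nat, act (wp w) b (coroot i) = n%:R.
Proof.
move=> red Pb dom; have [iwJ siw] := (reduced_wlen D J _).1 red.
have [iJ wJ] := andP iwJ.
have px : parabolic J (wp w)^-1%g by exact/gen_inv/parabolic_word.
have [|n n0 en] := root_positive px iJ.
  have -> : ((wp w)^-1 * s i = (wp (i :: w))^-1)%g by rewrite wp_cons invgM invs.
  rewrite !wlen_inv; try exact: parabolic_word.
  by rewrite -siw /=; apply: leq_trans (wlen_le _ wJ) _.
have [z hz] := rd_lattice_int i (lattice_act (wp w) Pb).
have : 0 <= act (wp w) b (coroot i) * form (alpha i) (alpha i).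
  rewrite coroot_act en rform_sumr mulr_sumr; apply: sumr_ge0 => j _.
  have [jJ|jJ] := boolP (j \in J); last by rewrite n0 // mulr0n rd_form_sym rform0l mulr0.
  rewrite rformMnr mulrnAr -coroot_form.
  have [m ->] := dom j jJ.
  by rewrite mulrn_wge0 // mulr_ge0 ?ler0n // ltW // rform_root_gt0.
rewrite pmulr_lge0 ?rform_root_gt0 // hz ler0z.
by case: z hz => // m _ _; exists m.
Qed.

Section Module.
Variable V : uq_module D t.

(** The exponent of [F_i] is the pairing of the current weight with [alpha_i^vee], so
    this divided power changes the weight by the reflection [s_i]. *)
Lemma F_word_weight (J : {set I}) w b (v : V) : reduced_word D J w -> P b ->
  (forall j, j \in J -> exists n : nat, b (coroot j) = n%:R) ->
  weight_vector b v -> weight_vector (act (wp w) b) (F_word b w v).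
Proof.
move=> red Pb dom wv; elim: w red => [|i w IH] red /=; first by rewrite wp_nil act1.
have redw : reduced_word D J w.
  have [/andP[iJ wJ] iwmin] := red; split=> // u uJ uw.
  have := iwmin (i :: u); rewrite /= iJ uJ !wp_cons uw ltnS; exact.
have [n en] := reduced_pairing_nat red Pb dom.
rewrite coreflection_pairing en Re_nat natrK wp_cons actM act_s en scaler_nat.
rewrite /divided_power; apply/weight_vectorZ/weight_iterF => //; last exact: IH.
exact: lattice_act.
Qed.

Lemma F_word0 b w : F_word b w (0 : V) = 0.
Proof. by elim: w => //= i w ->; rewrite /divided_power iter_linear0 scaler0. Qed.

Hypothesis V_int : category_Oint V.

Let V_weight : weight_module V. Proof. by case: V_int. Qed.
Let V_nil i : locally_nilpotent (uqF V i). Proof. by case: V_int. Qed.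

(** The vectors [E_j (x b)] have distinct weights and add up to [E_j v = 0]. *)
Lemma highest_component (J : {set I}) (v : V) bs x :
  (forall j, j \in J -> uqE V j v = 0) -> weight_decomposition v bs x ->
  forall j b, j \in J -> b \in bs -> uqE V j (x b) = 0.
Proof.
move=> Ev [ubs xw ve] j b jJ bbs; have [_ indep] := V_weight.
pose x' b' := uqE V j (x (b' - alpha j)).
have := indep [seq b + alpha j | b <- bs] x'.
rewrite /x' => H; rewrite -[x b](congr1 x (addrK (alpha j) b)); apply: H; last by apply: map_f.
split.
- by rewrite map_inj_uniq //; apply: addIr.
- move=> _ /mapP[c cbs ->]; have [Pc wc] := xw c cbs; rewrite addrK.
  split; first by apply: latticeD => //; exact: rd_root_lattice.
  exact: weight_E.
- rewrite big_map; under eq_bigr do rewrite addrK.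
  by rewrite -linear_sum -ve Ev.
Qed.

Lemma sigma_highest (J : {set I}) f w b (v : V) : sigma_spec J f ->
  reduced_word D J w -> wp w = longest D J ->
  (forall j, j \in J -> uqE V j v = 0) -> P b -> weight_vector b v ->
  f v = F_word b w v.
Proof.
move=> [f1 _ _] red ew Ev Pb wv.
rewrite (f1 v Ev [:: b] (fun=> v) w) ?big_seq1 //.
by split=> // [c|]; rewrite ?big_seq1 // inE => /eqP ->.
Qed.

Lemma sigma_highest_weight (J : {set I}) f b (v : V) : finite_type D J ->
  sigma_spec J f -> (forall j, j \in J -> uqE V j v = 0) ->
  P b -> weight_vector b v -> weight_vector (act (longest D J) b) (f v).
Proof.
move=> fJ fs Ev Pb wv.
have [w [red ew _]] := longestP fJ.
rewrite (sigma_highest fs red ew Ev Pb wv) -ew.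
have [->|v0] := eqVneq v 0; first by rewrite F_word0; exact: weight_vector0.
apply: (F_word_weight red Pb _ wv) => j jJ.
exact: (highest_weight_dominant t0 t_nroot (V_nil j) Pb wv (Ev j jJ)).
Qed.

Lemma uqKK l (v : V) : half l -> uqK V l (uqK V (- l) v) = v.
Proof. by move=> hl; rewrite uqKD ?subrr ?uqK0 //; exact: half_opp. Qed.

Definition twist (f : {linear V -> V}) (l m : h') : {linear V -> V} :=
  uqK V m \o f \o uqK V l.

(** On a highest weight vector of weight [b] the two scalars [q^((l, b))] and
    [q^(- (w_J l, w_J b))] cancel; in the relations with [E_j] and [F_j] the scalars
    cancel because [w_J alpha_j = - alpha_(star j)]. *)
Lemma twist_sigma (J : {set I}) f l : finite_type D J -> half l ->
  sigma_spec J f -> sigma_spec J (twist f l (- act (longest D J) l)).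
Proof.
move=> fJ hl fs; have [f1 f2 f3] := fs; set w := longest D J.
have hwl : half (act w l) by exact: half_act.
have hN : half (- act w l) by exact: half_opp.
have wstar j : j \in J -> form (- act w l) (alpha (star D J j)) = form l (alpha j).
  move=> jJ; have [_ e _] := starP fJ jJ.
  by rewrite -[alpha (star D J j)]opprK -e rformNl rformNr opprK rform_act.
have int j : q_integral D (form l (alpha j)) by exact: q_integral_form hl (rd_root_lattice D j).
have u j : qp (form l (alpha j)) != 0 by exact: qpow_neq0.
split.
- move=> v Ev bs x u0 dec red eu.
  have [ubs xw ve] := dec.
  rewrite {1}ve linear_sum big_seq [RHS]big_seq; apply: eq_bigr => b bbs.
  have [Pb wb] := xw b bbs.
  have Exb j : j \in J -> uqE V j (x b) = 0
    by move=> jJ; exact: highest_component Ev dec j b jJ bbs.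
  have wf := sigma_highest_weight fJ fs Exb Pb wb.
  rewrite /twist /= wb // !linearZ /=.
  rewrite (wf _ hN) scalerA rformNl rform_act.
  have ib := q_integral_form hl Pb.
  rewrite qpowN // divff ?qpow_neq0 // scale1r.
  exact: sigma_highest fs red eu Exb Pb wb.
- move=> j v jJ; rewrite /twist /= uqKF // linearZ /= f2 // linearZ /= uqKE // wstar //.
  by rewrite scalerA qpowN // mulVf // scale1r.
- move=> j v jJ; rewrite /twist /= uqKE // linearZ /= f3 // linearZ /= uqKF // wstar //.
  by rewrite scalerA qpowN // mulfV // scale1r.
Qed.

(** The twisted operator satisfies the conditions that determine [sigma^J]. *)
Lemma sigma_K (J : {set I}) f l (v : V) : finite_type D J -> half l -> is_sigma J f ->
  f (uqK V l v) = uqK V (act (longest D J) l) (f v).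
Proof.
move=> fJ hl [fs funiq].
rewrite -(funiq _ (twist_sigma fJ hl fs) v) /twist /= uqKK //.
exact: half_act.
Qed.

Lemma sigma_weight (J : {set I}) f b (v : V) : finite_type D J -> is_sigma J f ->
  weight_vector b v -> weight_vector (act (longest D J) b) (f v).
Proof.
move=> fJ fs wv l hl; have hwl : half (act (longest D J) l) by exact: half_act.
rewrite -[l in LHS](longestK _ fJ) -sigma_K // wv // linearZ /=.
by rewrite -(rform_act (longest D J)) longestK.
Qed.

Lemma tauV (J : finite_subset D) : (tau J)^-1%g = tau J.
Proof.
suff e : (tau J * tau J)%g = 1%g by apply: (mulgI (tau J)); rewrite mulgV e.
transitivity (word_class (cactus_rel (D := D)) ([:: (J, true)] ++ [:: (J, true)])).
  exact: (presented_mulE (cactus_rel (D := D))).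
by apply/word_classP; apply: (weq_rel (cactus_involution J)).
Qed.

Lemma action_weight (rho : cactus D -> {linear V -> V}) (psi : {multiplicative cactus D -> W}) :
  cactus_action rho -> (forall J, psi (tau J) = longest D (val J)) ->
  forall x b (v : V), weight_vector b v -> weight_vector (act (psi x) b) (rho x v).
Proof.
move=> [rho1 rhoM rhos] psit x.
have gen J b (v : V) : weight_vector b v -> weight_vector (act (psi (tau J)) b) (rho (tau J) v).
  move=> wv; rewrite psit; apply: sigma_weight => //; exact: (valP J).
elim/presented_ind: x => [b v wv|J|J|x y hx hy b v wv].
- by rewrite multiplicative1 act1 rho1.
- exact: gen.
- rewrite tauV; exact: gen.
- by rewrite gmulfM actM rhoM; apply/hx/hy.
Qed.
End Module.
End SigmaWeights.

(** * Highest weight modules in functions on words *)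

Section WordFunctions.
Variables (R : realType) (I : finType) (D : root_datum R I) (k : fieldType) (t : k).

Local Notation h := (rd_h D).
Local Notation h' := 'Hom(h, R[i]^o).
Local Notation alpha := (rd_root D).
Local Notation form := (@rd_form _ _ D).
Local Notation P := (@rd_lattice _ _ D).
Local Notation qp := (qpow D t).
Local Notation q := (q_ D t).
Local Notation FW := (seq I -> k^o).

Definition word_weight (m : h') (w : seq I) : h' := foldl (fun m j => m - alpha j) m w.

Lemma word_weight_sub m a w : word_weight (m - a) w = word_weight m w - a.
Proof. by elim: w m => //= j w IH m; rewrite addrAC IH. Qed.

Lemma word_weight_rcons m w j : word_weight m (rcons w j) = word_weight m w - alpha j.
Proof. by rewrite /word_weight foldl_rcons. Qed.

Lemma word_weight_lattice m w : P m -> P (word_weight m w).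
Proof.
elim: w m => //= j w IH m Pm; apply/IH/latticeB => //; exact: rd_root_lattice.
Qed.

(** The scalar by which [[E_i, F_i]] acts on vectors of weight [m]. *)
Definition commutator_coeff (i : I) (m : h') : k :=
  (q i - (q i)^-1)^-1 * (qp (form (alpha i) m) - qp (form (- alpha i) m)).

(** With the value at [w] read as the coefficient of the highest weight vector in
    [E_w v], this is the action of [E_i]. *)
Definition raising (i : I) (f : FW) : FW := fun w => f (rcons w i).

(** Moving [F_i] to the left through [E_w] gives one commutator for each occurrence
    of [i] in [w], evaluated at the weight of the highest weight vector lowered by
    the letters before it; [m] is this weight. The term with [F_i] on the left
    contributes nothing to the highest weight. *)
Fixpoint lowering_at (i : I) (m : h') (f : FW) (w : seq I) : k :=
  if w is j :: w' then
    (if j == i then commutator_coeff i m * f w' else 0) +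
    lowering_at i (m - alpha j) (fun u => f (j :: u)) w'
  else 0.

Variable lam : h'.

Definition lowering (i : I) (f : FW) : FW := lowering_at i lam f.

(** The operators that are scalar on each weight; the [K_l] and the commutators
    [[E_i, F_i]] are of this kind. *)
Definition weight_scaling (g : h' -> k) (f : FW) : FW := fun w => g (word_weight lam w) * f w.

Lemma raising_is_linear i : linear (raising i).
Proof. by []. Qed.
HB.instance Definition _ i := GRing.isLinear.Build k FW FW _ (raising i) (raising_is_linear i).

Lemma lowering_at_linear i m a f g w :
  lowering_at i m (fun u => a * f u + g u) w = a * lowering_at i m f w + lowering_at i m g w.
Proof.
elim: w m f g => [|j w IH] m f g /=; first by rewrite mulr0 addr0.
by rewrite IH; case: (j == i); ring.
Qed.

Lemma lowering_is_linear i : linear (lowering i).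
Proof. by move=> a f g; apply/funext => w; exact: lowering_at_linear. Qed.
HB.instance Definition _ i := GRing.isLinear.Build k FW FW _ (lowering i) (lowering_is_linear i).

Lemma weight_scaling_is_linear g : linear (weight_scaling g).
Proof.
move=> a f f'; apply/funext => w; rewrite /weight_scaling.
transitivity (g (word_weight lam w) * (a * f w + f' w)) => //.
by rewrite mulrDr mulrCA.
Qed.
HB.instance Definition _ g :=
  GRing.isLinear.Build k FW FW _ (weight_scaling g) (weight_scaling_is_linear g).

Lemma raising_lowering i j f : raising i (lowering j f) =
  lowering j (raising i f) + (if i == j then weight_scaling (commutator_coeff i) f else 0).
Proof.
apply/funext => w; rewrite /raising /lowering /weight_scaling.
rewrite -[(_ + _) w]/(_ + _).
transitivity (lowering_at j lam (fun u => f (rcons u i)) w +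
    (if i == j then commutator_coeff i (word_weight lam w) * f w else 0)); last first.
  by case: (i == j).
elim: w lam f => [|l w IH] m f /=; first by case: eqP => [->|_]; rewrite ?addr0 ?add0r.
by rewrite IH addrA.
Qed.

Lemma raising_weight_scaling i g f :
  raising i (weight_scaling g f) = weight_scaling (fun m => g (m - alpha i)) (raising i f).
Proof. by apply/funext => w; rewrite /raising /weight_scaling word_weight_rcons. Qed.

Lemma weight_scaling_lowering i g f :
  weight_scaling g (lowering i f) = lowering i (weight_scaling (fun m => g (m - alpha i)) f).
Proof.
apply/funext => w; rewrite /weight_scaling /lowering.
elim: w lam f => [|j w IH] m f /=; first by rewrite mulr0.
rewrite mulrDr IH; congr (_ + _).
case: eqP => [->|_]; last by rewrite mulr0.
by rewrite -word_weight_sub mulrCA.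
Qed.

Lemma lowering_support i m f w : lowering_at i m f w != 0 ->
  exists u, [/\ f u != 0, word_weight m w = word_weight m u - alpha i & size w = (size u).+1].
Proof.
elim: w m f => [|j w IH] m f /=; first by rewrite eqxx.
have [-> h0|/IH[u [fu eu su]] _] := eqVneq (lowering_at i (m - alpha j) (fun u => f (j :: u)) w) 0.
  move: h0; case: (j =P i) => [->|_]; last by rewrite addr0 eqxx.
  rewrite addr0 => h0; exists w; split=> //; last by rewrite word_weight_sub.
  by apply: contraNneq h0 => ->; rewrite mulr0.
by exists (j :: u); split=> //=; rewrite su.
Qed.

Definition vacuum : FW := fun w => (w == [::])%:R.

Lemma raising_vacuum i : raising i vacuum = 0.
Proof. by apply/funext => w; rewrite /raising /vacuum; case: w. Qed.

Lemma weight_scaling_vacuum g : weight_scaling g vacuum = g lam *: vacuum.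
Proof.
apply/funext => w; rewrite /weight_scaling -[(_ *: _) w]/(_ * _) /vacuum.
by case: w => [|j w] //=; rewrite !mulr0.
Qed.

(** The submodule generated by the highest weight vector. Only lowering operators
    are used; stability under the other operators is a consequence of the
    commutation rules. *)
Inductive generated_by_vacuum : FW -> Prop :=
| gbv_vacuum : generated_by_vacuum vacuum
| gbv_linear a f g : generated_by_vacuum f -> generated_by_vacuum g ->
    generated_by_vacuum (a *: f + g)
| gbv_lowering i f : generated_by_vacuum f -> generated_by_vacuum (lowering i f).

Lemma gbv0 : generated_by_vacuum 0.
Proof. by rewrite -(addNr vacuum) -scaleN1r; apply: gbv_linear; exact: gbv_vacuum. Qed.
Lemma gbvZ a f : generated_by_vacuum f -> generated_by_vacuum (a *: f).
Proof. by move=> hf; rewrite -[_ *: _]addr0; apply: gbv_linear => //; exact: gbv0. Qed.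

Lemma gbv_weight_scaling g f : generated_by_vacuum f -> generated_by_vacuum (weight_scaling g f).
Proof.
move=> hf; elim: hf g => {f} [|a f f' _ hf _ hf'|i f _ hf] g.
- by rewrite weight_scaling_vacuum; apply/gbvZ/gbv_vacuum.
- by rewrite linearP; apply: gbv_linear; [exact: hf|exact: hf'].
- by rewrite weight_scaling_lowering; apply/gbv_lowering/hf.
Qed.

Lemma gbv_raising i f : generated_by_vacuum f -> generated_by_vacuum (raising i f).
Proof.
elim=> {f} [|a f g _ hf _ hg|j f gf hf].
- by rewrite raising_vacuum; exact: gbv0.
- by rewrite linearP; apply: gbv_linear.
- rewrite raising_lowering -[X in generated_by_vacuum X]scale1r scalerDr scale1r.
  rewrite -[lowering j _]scale1r.
  by apply: gbv_linear; [exact: gbv_lowering|apply: gbvZ; case: eqP => _;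
    [exact: gbv_weight_scaling|exact: gbv0]].
Qed.

Definition in_irreducible : {pred FW} := fun f => `[< generated_by_vacuum f >].

Lemma in_irreducible_closed : submod_closed in_irreducible.
Proof.
split; first exact/asboolP/gbv0.
by move=> a f g /asboolP hf /asboolP hg; apply/asboolP/gbv_linear.
Qed.

Definition irreducible := {f : FW | in_irreducible f}.
HB.instance Definition _ := Choice.on irreducible.
HB.instance Definition _ := [isSub of irreducible for (@sval FW _)].
HB.instance Definition _ :=
  GRing.SubChoice_isSubLmodule.Build k FW in_irreducible irreducible in_irreducible_closed.

Lemma irr_generated (x : irreducible) : generated_by_vacuum (val x).
Proof. exact/asboolP/(valP x). Qed.

Definition irr (f : FW) (hf : generated_by_vacuum f) : irreducible :=
  exist in_irreducible f (introT (asboolP _) hf).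

Definition irr_E i (x : irreducible) : irreducible := irr (gbv_raising i (irr_generated x)).
Definition irr_F i (x : irreducible) : irreducible := irr (gbv_lowering i (irr_generated x)).
Definition irr_weight_scaling g (x : irreducible) : irreducible :=
  irr (gbv_weight_scaling g (irr_generated x)).

Lemma irr_E_is_linear i : linear (irr_E i).
Proof. by move=> a x y; apply: val_inj; rewrite /= !linearP. Qed.
Lemma irr_F_is_linear i : linear (irr_F i).
Proof. by move=> a x y; apply: val_inj; rewrite /= !linearP. Qed.
Lemma irr_weight_scaling_is_linear g : linear (irr_weight_scaling g).
Proof. by move=> a x y; apply: val_inj; rewrite /= !linearP. Qed.
HB.instance Definition _ i :=
  GRing.isLinear.Build k irreducible irreducible _ (irr_E i) (irr_E_is_linear i).
HB.instance Definition _ i :=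
  GRing.isLinear.Build k irreducible irreducible _ (irr_F i) (irr_F_is_linear i).
HB.instance Definition _ g :=
  GRing.isLinear.Build k irreducible irreducible _ (irr_weight_scaling g)
    (irr_weight_scaling_is_linear g).

End WordFunctions.

(** * The defining relations on the highest weight module *)

Section IrreducibleModule.
Variables (R : realType) (I : finType) (D : root_datum R I) (k : fieldType) (t : k).
Hypothesis t0 : t != 0.
Hypothesis t_nroot : forall n, (0 < n)%N -> t ^+ n != 1.

Local Notation h := (rd_h D).
Local Notation h' := 'Hom(h, R[i]^o).
Local Notation alpha := (rd_root D).
Local Notation form := (@rd_form _ _ D).
Local Notation P := (@rd_lattice _ _ D).
Local Notation half := (@half_lattice _ _ D).
Local Notation qp := (qpow D t).
Local Notation q := (q_ D t).
Local Notation FW := (seq I -> k^o).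
Local Notation ra := (@raising I k).
Local Notation a_ := (rd_cartan D).

Variable lam : h'.
Hypothesis Plam : P lam.

Local Notation lo := (@lowering R I D k t lam).
Local Notation dia := (@weight_scaling R I D k lam).
Local Notation wt := (@word_weight R I D lam).

Let qint_wt l w : half l -> q_integral D (form l (wt w)).
Proof. by move=> hl; apply: q_integral_form => //; exact: word_weight_lattice. Qed.
Let qint_root l i : half l -> q_integral D (form l (alpha i)).
Proof. by move=> hl; apply: q_integral_form => //; exact: rd_root_lattice. Qed.

Lemma weight_scaling_ext g g' c (f : FW) : (forall w, g (wt w) = c * g' (wt w)) ->
  dia g f = c *: dia g' f.
Proof.
move=> e; apply/funext => w; transitivity (c * (g' (wt w) * f w)) => //.
by rewrite /weight_scaling e mulrA.
Qed.

Local Notation K l := (dia (fun m => qp (form l m))).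

Lemma K_lowering l i f : half l -> K l (lo i f) = qp (- form l (alpha i)) *: lo i (K l f).
Proof.
move=> hl; rewrite weight_scaling_lowering -linearZ; congr (lo i _).
apply: weight_scaling_ext => w; rewrite rformBr qpowB ?qpowN 1?mulrC //.
- exact: qint_root.
- exact: qint_wt.
- exact: qint_root.
Qed.

Lemma K_raising l i f : half l -> K l (ra i f) = qp (form l (alpha i)) *: ra i (K l f).
Proof.
move=> hl; rewrite raising_weight_scaling -[LHS]scale1r.
rewrite -(divff (qpow_neq0 t0 (qint_root i hl))) -scalerA; congr (_ *: _).
apply/esym; apply: weight_scaling_ext => w; rewrite rformBr qpowB 1?mulrC //.
- exact: qint_wt.
- exact: qint_root.
Qed.

Let qpN_root l i : half l -> qp (- form l (alpha i)) = (qp (form l (alpha i)))^-1.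
Proof. by move=> hl; rewrite qpowN //; exact: qint_root. Qed.

Lemma commutator i j f : ra i (lo j f) - lo j (ra i f) =
  if i == j then (q i - (q i)^-1)^-1 *: (K (alpha i) f - K (- alpha i) f) else 0.
Proof.
rewrite raising_lowering addrC addKr; case: eqP => // _; apply/funext => w.
transitivity (commutator_coeff t i (wt w) * f w) => //.
rewrite /commutator_coeff -mulrA mulrBl.
by [].
Qed.

Let cartanE i j : exists n : nat, i != j -> a_ i j = - n%:Z.
Proof.
by exists `|a_ i j|%N => nij; have := cartan_le0 D nij; lia.
Qed.

Let serre_lowering_raising i j N m f : i != j -> a_ i j = - N%:Z ->
  ra m (serre lo q i j N.+1 f) = serre lo q i j N.+1 (ra m f).
Proof.
move=> nij aN.
apply: (@serre_commute _ _ FW ra lo (fun i => K (alpha i)) (fun i => K (- alpha i)) q a_) => //.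
- exact: q_neq0.
- by move=> i' n; exact: q_nroot.
- exact: commutator.
- by move=> i' j' x; rewrite /= K_lowering ?qpN_root ?qpow_root_root ?invr_expz //; exact: half_root.
- move=> i' j' x; rewrite /= K_lowering ?rformNl ?opprK ?qpow_root_root //.
  exact/half_opp/half_root.
- exact: cartan_diag.
- exact: q_sym.
Qed.

Let serre_raising_lowering i j N m f : i != j -> a_ i j = - N%:Z ->
  lo m (serre ra q i j N.+1 f) = serre ra q i j N.+1 (lo m f).
Proof.
move=> nij aN.
apply: (@serre_commute _ _ FW lo ra (fun i => K (- alpha i)) (fun i => K (alpha i)) q a_) => //.
- exact: q_neq0.
- by move=> i' n; exact: q_nroot.
- move=> i' j' x; rewrite -opprB commutator eq_sym; case: eqP => [->|_]; last by rewrite oppr0.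
  by rewrite -scalerN opprB.
- move=> i' j' x; rewrite /= K_raising ?rformNl ?qpN_root ?qpow_root_root ?invr_expz //.
    exact: half_root.
  exact/half_opp/half_root.
- by move=> i' j' x; rewrite /= K_raising ?qpow_root_root //; exact: half_root.
- exact: cartan_diag.
- exact: q_sym.
Qed.

(** In the model, a singular vector of weight other than the highest one is zero by
    construction. *)
Lemma raising_separates (f : FW) : f [::] = 0 -> (forall i, ra i f = 0) -> f = 0.
Proof.
move=> f0 fE; apply/funext => w; case/lastP: w => [|w i] //.
by have /(congr1 (fun g : FW => g w)) := fE i.
Qed.

(** Since the Serre expression commutes with the raising operators, the last letter
    of the word at which it is evaluated can be removed; at the empty word every
    term vanishes, being in the image of a lowering operator. *)
Lemma serre_lowering i j N f : i != j -> a_ i j = - N%:Z -> serre lo q i j N.+1 f = 0.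
Proof.
move=> nij aN; apply/funext => w; elim/last_ind: w f => [|w m IH] f; last first.
  rewrite -[LHS]/(ra m (serre lo q i j N.+1 f) w) serre_lowering_raising // IH //.
rewrite /serre fct_sumE big1 // => r _.
rewrite -[LHS]/((-1) ^+ r * _) /divided_power -[X in _ * X = _]/(_ * _).
by case: (nat_of_ord r) => [|r'] /=; rewrite !mulr0.
Qed.

(** The Serre expression kills the highest weight vector and commutes with the
    lowering operators, which generate everything from this vector. *)
Lemma serre_raising i j N f : i != j -> a_ i j = - N%:Z -> generated_by_vacuum t lam f ->
  serre ra q i j N.+1 f = 0.
Proof.
move=> nij aN; elim=> {f} [|c f g _ hf _ hg|m f _ hf].
- rewrite /serre big1 // => r _.
  have iter0 n : iter n.+1 (ra i) (@vacuum I k) = 0.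
    by elim: n => [|n IH]; rewrite iterS ?IH ?linear0 //= raising_vacuum.
  have e : ra j (divided_power (q i) (ra i) (N.+1 - r) (@vacuum I k)) = 0.
    case: (N.+1 - r)%N => [|n]; first by rewrite divided_power0 raising_vacuum.
    by rewrite /divided_power iter0 scaler0 linear0.
  transitivity ((-1) ^+ r *: divided_power (q i) (ra i) r (ra j
    (divided_power (q i) (ra i) (N.+1 - r) (@vacuum I k)))) => //.
  by rewrite e /divided_power iter_linear0 !scaler0.
- by rewrite serre_linear hf hg scaler0 addr0.
- by rewrite -serre_raising_lowering // hf linear0.
Qed.

Local Notation L := (@irreducible R I D k t lam).
Local Notation LE := (@irr_E R I D k t lam).
Local Notation LF := (@irr_F R I D k t lam).
Local Notation LK := (fun l => @irr_weight_scaling R I D k t lam (fun m => qp (form l m))).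

Lemma val_sum (J : finType) (f : J -> L) : val (\sum_j f j) = \sum_j val (f j) :> FW.
Proof. exact: (raddf_sum (val : {additive L -> FW})). Qed.

Lemma val_iter (G : L -> L) (G' : FW -> FW) n x :
  (forall y, val (G y) = G' (val y)) -> val (iter n G x) = iter n G' (val x) :> FW.
Proof. by move=> e; elim: n => //= n <-; rewrite e. Qed.

Lemma val_divided_power (u : k) (G : L -> L) (G' : FW -> FW) n x :
  (forall y, val (G y) = G' (val y)) ->
  val (divided_power u G n x) = divided_power u G' n (val x) :> FW.
Proof. by move=> e; rewrite /divided_power -(val_iter _ _ e). Qed.

Lemma irr_K0 v : LK 0 v = v.
Proof.
apply: val_inj; apply/funext => w /=; rewrite /weight_scaling rform0l qpow0 //.
exact: mul1r.
Qed.

Lemma irr_KD l m v : half l -> half m -> LK l (LK m v) = LK (l + m) v.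
Proof.
move=> hl hm; apply: val_inj; apply/funext => w /=; rewrite /weight_scaling mulrA.
by rewrite rformDl qpowD //; exact: qint_wt.
Qed.

Lemma irr_KE l i v : half l -> LK l (LE i v) = qp (form l (alpha i)) *: LE i (LK l v).
Proof. by move=> hl; apply: val_inj; exact: K_raising. Qed.

Lemma irr_KF l i v : half l -> LK l (LF i v) = qp (- form l (alpha i)) *: LF i (LK l v).
Proof. by move=> hl; apply: val_inj; exact: K_lowering. Qed.

Lemma irr_EF i j v : LE i (LF j v) - LF j (LE i v) =
  if i == j then (q i - (q i)^-1)^-1 *: (LK (alpha i) v - LK (- alpha i) v) else 0.
Proof.
apply: val_inj; transitivity (ra i (lo j (val v)) - lo j (ra i (val v))) => //.
by rewrite commutator; case: eqP.
Qed.

Lemma irr_serreE i j v : i != j ->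
  \sum_(r < `|(1 - a_ i j)%R|.+1)
      (-1) ^+ r *: divided_power (q i) (LE i) r
        (LE j (divided_power (q i) (LE i) (`|(1 - a_ i j)%R| - r)%N v)) = 0.
Proof.
move=> nij; have [N /(_ nij) aN] := cartanE i j.
have -> : `|(1 - a_ i j)%R|%N = N.+1 by rewrite aN; lia.
apply: val_inj; rewrite val_sum -[RHS](serre_raising nij aN (irr_generated v)).
have e n x : val (divided_power (q i) (LE i) n x) = divided_power (q i) (ra i) n (val x) :> FW.
  exact: val_divided_power.
apply: eq_bigr => r _.
transitivity ((-1) ^+ r *: val (divided_power (q i) (LE i) r
  (LE j (divided_power (q i) (LE i) (N.+1 - r) v))) : FW) => //.
by rewrite e -[val (LE j _)]/(ra j (val _)) e.
Qed.

Lemma irr_serreF i j v : i != j ->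
  \sum_(r < `|(1 - a_ i j)%R|.+1)
      (-1) ^+ r *: divided_power (q i) (LF i) r
        (LF j (divided_power (q i) (LF i) (`|(1 - a_ i j)%R| - r)%N v)) = 0.
Proof.
move=> nij; have [N /(_ nij) aN] := cartanE i j.
have -> : `|(1 - a_ i j)%R|%N = N.+1 by rewrite aN; lia.
apply: val_inj; rewrite val_sum -[RHS](serre_lowering (val v) nij aN).
have e n x : val (divided_power (q i) (LF i) n x) = divided_power (q i) (lo i) n (val x) :> FW.
  exact: val_divided_power.
apply: eq_bigr => r _.
transitivity ((-1) ^+ r *: val (divided_power (q i) (LF i) r
  (LF j (divided_power (q i) (LF i) (N.+1 - r) v))) : FW) => //.
by rewrite e -[val (LF j _)]/(lo j (val _)) e.
Qed.

Definition irreducible_module : uq_module D t :=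
  @UqModule R I D k t L LE LF LK irr_K0 irr_KD irr_KE irr_KF irr_EF irr_serreE irr_serreF.

End IrreducibleModule.

(** * Integrability of the highest weight module *)

Section IrreducibleIntegrable.
Variables (R : realType) (I : finType) (D : root_datum R I) (k : fieldType) (t : k).
Hypothesis t0 : t != 0.
Hypothesis t_nroot : forall n, (0 < n)%N -> t ^+ n != 1.

Local Notation h := (rd_h D).
Local Notation h' := 'Hom(h, R[i]^o).
Local Notation alpha := (rd_root D).
Local Notation coroot := (rd_coroot D).
Local Notation form := (@rd_form _ _ D).
Local Notation P := (@rd_lattice _ _ D).
Local Notation qp := (qpow D t).
Local Notation q := (q_ D t).
Local Notation FW := (seq I -> k^o).
Local Notation ra := (@raising I k).
Local Notation a_ := (rd_cartan D).

Variable lam : h'.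
Hypothesis Plam : P lam.

Local Notation lo := (@lowering R I D k t lam).
Local Notation dia := (@weight_scaling R I D k lam).
Local Notation wt := (@word_weight R I D lam).
Local Notation K l := (dia (fun m => qp (form l m))).
Local Notation gbv := (generated_by_vacuum t lam).
Local Notation L := (@irreducible R I D k t lam).
Local Notation V := (irreducible_module t0 t_nroot Plam).

Lemma finite_weights f : gbv f -> exists bs : seq h', forall w, f w != 0 -> wt w \in bs.
Proof.
elim=> {f} [|a f g _ [bs hb] _ [cs hc]|i f _ [bs hb]].
- by exists [:: lam] => w; rewrite /vacuum; case: w => [|j w]; rewrite ?inE //= eqxx.
- exists (bs ++ cs) => w h0; rewrite mem_cat.
  have [f0|/hb -> //] := eqVneq (f w) 0.
  rewrite hc ?orbT //; apply: contraNneq h0 => g0.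
  by rewrite -[(_ + _) w]/(a * f w + g w) f0 g0 mulr0 addr0.
- exists [seq b - alpha i | b <- bs] => w /lowering_support[u [/hb ub -> _]].
  exact: map_f.
Qed.

Lemma finite_length f : gbv f -> exists N, forall w, (N <= size w)%N -> f w = 0.
Proof.
elim=> {f} [|a f g _ [m hm] _ [n hn]|i f _ [n hn]].
- by exists 1%N => w; rewrite /vacuum; case: w.
- exists (maxn m n) => w; rewrite geq_max => /andP[mw nw].
  by rewrite -[(_ + _) w]/(a * f w + g w) hm // hn // mulr0 addr0.
- exists n.+1 => w nw; apply/eqP; apply: contraT => /lowering_support[u [fu _ su]].
  by rewrite hn ?eqxx // in fu; rewrite su in nw.
Qed.

Lemma irr_weight_vectorP b (x : V) : P b ->
  weight_vector b x <-> forall w, val (x : L) w != 0 -> wt w = b.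
Proof.
move=> Pb; split=> [wx w xw|hx l hl].
  apply: (lattice_separation t0 t_nroot) => //; first exact: word_weight_lattice.
  move=> l Pl; have := wx l (lattice_half Pl).
  move=> /(congr1 (fun y : L => val y w)) e.
  by apply: (mulIf xw).
apply: val_inj; apply/funext => w.
transitivity (qp (form l (wt w)) * val (x : L) w) => //.
have [x0|/hx ->] := eqVneq (val (x : L) w) 0; last by [].
by rewrite x0 mulr0 -[RHS]/(_ * val (x : L) w) x0 mulr0.
Qed.

Lemma irr_weight_module : weight_module V.
Proof.
split=> [v|bs x [ubs xw e0] b bbs].
  have [bs hbs] := finite_weights (irr_generated (v : L)).
  pose cs := [seq b <- undup bs | `[< P b >]].
  pose x (b : h') : V := irr_weight_scaling (fun m => (m == b)%:R) (v : L).
  exists cs, x; split; first by rewrite filter_uniq ?undup_uniq.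
    move=> b; rewrite mem_filter => /andP[/asboolP Pb _]; split=> //.
    apply/irr_weight_vectorP => // w.
    rewrite -[val _ w]/((wt w == b)%:R * val (v : L) w).
    by case: (wt w =P b) => // _; rewrite mul0r eqxx.
  apply: val_inj; apply/funext => w.
  transitivity (\sum_(b <- cs) val (x b : L) w); last first.
    elim: cs => [|b cs IH]; first by rewrite !big_nil.
    by rewrite !big_cons IH.
  transitivity (\sum_(b <- cs) (wt w == b)%:R * val (v : L) w) => //.
  have [v0|vw] := eqVneq (val (v : L) w) 0.
    by rewrite v0 big1 // => b _; rewrite mulr0.
  rewrite (bigD1_seq (wt w)) /= ?filter_uniq ?undup_uniq //; last first.
    rewrite mem_filter mem_undup hbs // andbT; apply/asboolP.
    exact: word_weight_lattice.
  rewrite eqxx mul1r big1 ?addr0 // => b; rewrite eq_sym => /negPf ->.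
  by rewrite mul0r.
apply/eqP; apply: contraT => xb0.
have [w xbw] : exists w, val (x b : L) w != 0.
  apply: contrapT => /forallNP H; move/eqP: xb0; apply; apply: val_inj; apply/funext => w.
  by apply/eqP; have := H w; case: eqP.
have [Pb wb] := xw b bbs.
have ewb := (irr_weight_vectorP (x b) Pb).1 wb w xbw.
have : \sum_(c <- bs) val (x c : L) w = 0.
  transitivity (val (\sum_(c <- bs) x c : L) w); last by rewrite -e0.
  elim: (bs) => [|c cs IH]; first by rewrite !big_nil.
  by rewrite !big_cons IH.
rewrite (bigD1_seq b) //= big_seq_cond big1 ?addr0.
  by move=> e; move/eqP: xbw => /(_ e).
move=> c /andP[cbs ncb]; apply/eqP; apply: contraT => xcw.
have [Pc wc] := xw c cbs.
by rewrite -((irr_weight_vectorP (x c) Pc).1 wc w xcw) ewb eqxx in ncb.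
Qed.

Lemma raising_word (v : L) u w :
  val (foldr (fun i => @irr_E R I D k t lam i) v u) w = val v (w ++ u).
Proof.
elim: u w => [|i u IH] w /=; first by rewrite cats0.
by rewrite /raising IH cat_rcons.
Qed.

Lemma irr_Uplus_finite : locally_Uplus_finite V.
Proof.
move=> v; have [N hN] := finite_length (irr_generated (v : L)).
exists N => n Nn u un; apply: val_inj; apply/funext => w.
rewrite [LHS]raising_word hN // size_cat (leq_trans _ (leq_addl _ _)) //.
suff -> : size u = (\sum_i n i)%N by [].
under eq_bigr do rewrite -un.
elim: (u) => [|j u' IH] /=; first by rewrite big1.
by rewrite big_split /= -IH (bigD1 j) //= eqxx big1 // => i /negPf; rewrite eq_sym => ->.
Qed.

Lemma irr_E_nilpotent i : locally_nilpotent (uqE V i).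
Proof.
move=> v; have [N hN] := finite_length (irr_generated (v : L)).
exists N; apply: val_inj; apply/funext => w.
have -> : iter N (uqE V i) v = foldr (fun j => uqE V j) v (nseq N i).
  by elim: (N) => //= n ->.
by rewrite [LHS]raising_word hN // size_cat size_nseq leq_addl.
Qed.

Hypothesis dom : forall i, exists n : nat, lam (coroot i) = n%:R.

(** This vector is killed by all raising operators: by [E_i] because [K] and
    [K'] act on the highest weight vector by [q_i^n] and [q_i^-n], so that the two
    terms in [sl2_iter] cancel. *)
Lemma lowering_vacuum_nilpotent i n : lam (coroot i) = n%:R ->
  iter n.+1 (lo i) (@vacuum I k) = 0.
Proof.
move=> en; apply: raising_separates => // j.
have [->|nji] := eqVneq j i; last first.
  suff H m f : ra j (iter m (lo i) f) = iter m (lo i) (ra j f).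
    by rewrite H raising_vacuum iter_linear0.
  elim: m => //= m IH; rewrite -IH; apply/eqP; rewrite -subr_eq0.
  by rewrite commutator (negPf nji).
have q2 : qp (form (alpha i) (alpha i)) = q i ^+ 2 by rewrite qpow_root_root cartan_diag.
have hi := half_root D i; have hNi := half_opp hi.
have ii := q_integral_form hi (rd_root_lattice D i).
have := @sl2_iter _ _ (q_neq0 D t0 i) (@q_nroot _ _ D _ _ t_nroot i) _ (ra i) (lo i)
  (K (alpha i)) (K (- alpha i)) _ _ _ n (@vacuum I k).
move=> /= ->.
- rewrite raising_vacuum iter_linear0 linear0 add0r !weight_scaling_vacuum rformNl.
  rewrite qpowN ?(@qpow_root _ _ D _ t i lam n) //; last exact: q_integral_form hi Plam.
  rewrite !scalerA -scalerBl -exprnP mulVf ?mulfV ?expf_neq0 ?q_neq0 //.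
  by rewrite subrr scale0r iter_linear0 scaler0.
- by move=> x; rewrite commutator eqxx.
- by move=> x; rewrite (K_lowering t0 Plam) // qpowN // q2.
- by move=> x; rewrite (K_lowering t0 Plam) // rformNl opprK q2.
Qed.

Lemma iter_eq0_leq (F : {linear FW -> FW}) m n f : (m <= n)%N -> iter m F f = 0 -> iter n F f = 0.
Proof. by move=> mn e; rewrite -(subnK mn) iterD e iter_linear0. Qed.

(** The Serre relation, solved for its term with all the factors [F_i] on the left. *)
Lemma lowering_serre_step i j N f : i != j -> a_ i j = - N%:Z ->
  exists c : nat -> k, iter N.+1 (lo i) (lo j f) =
    \sum_(r < N.+1) c r *: iter r (lo i) (lo j (iter (N.+1 - r) (lo i) f)).
Proof.
move=> nij aN; have := serre_lowering t0 t_nroot Plam f nij aN.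
rewrite /serre big_ord_recr /= subnn divided_power0 => /eqP.
rewrite addrC addr_eq0 => /eqP e.
have f0 : qfact (q i) N.+1 != 0.
  by apply: (qfact_neq0 (q_neq0 D t0 i)) => n; exact: q_nroot.
pose d r := - ((-1) ^+ N.+1)^-1 * qfact (q i) N.+1 * (-1) ^+ r /
   (qfact (q i) r * qfact (q i) (N.+1 - r)).
exists d.
have s0 : (-1) ^+ N.+1 != 0 :> k by rewrite signr_eq0.
transitivity ((((-1) ^+ N.+1)^-1 * qfact (q i) N.+1) *:
   ((-1) ^+ N.+1 *: divided_power (q i) (lo i) N.+1 (lo j f))).
  rewrite -[LHS]scale1r /divided_power !scalerA; congr (_ *: _).
  move: ((-1) ^+ N.+1) s0 (qfact _ _) f0 => x x0 y y0.
  by field; rewrite x0 y0.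
rewrite e scalerN scaler_sumr -sumrN; apply: eq_bigr => r _.
rewrite /divided_power [lo j (_ *: _)]linearZ iter_linearZ !scalerA -scaleNr; congr (_ *: _).
by rewrite /d invfM; ring.
Qed.

(** Each use of the Serre relation moves at least one factor [F_i] to the right of
    [F_j] at the cost of [N + 1] factors on the left, so [F_i^d f = 0] implies
    [F_i^(d (N + 1)) F_j f = 0]. *)
Lemma lowering_nilpotent_step i j f n : iter n (lo i) f = 0 ->
  exists m, iter m (lo i) (lo j f) = 0.
Proof.
move=> fn; have [<-|nij] := eqVneq i j.
  by exists n; rewrite -iterSr /= fn linear0.
have [N aN] : exists N : nat, a_ i j = - N%:Z.
  by exists `|a_ i j|%N; have := cartan_le0 D nij; lia.
suff H d : forall f, iter d (lo i) f = 0 -> iter (d * N.+1) (lo i) (lo j f) = 0.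
  by exists (n * N.+1)%N; exact: H.
elim: d => [|d IH] {fn}{}f fd; first by rewrite /= in fd; rewrite fd /= linear0.
rewrite mulSn addnC iterD; have [c ->] := lowering_serre_step f nij aN.
rewrite (big_morph (iter (d * N.+1) (lo i)) (id1 := 0) (op1 := +%R)).
- apply: big1 => r _; rewrite iter_linearZ -iterD.
  rewrite (iter_eq0_leq (leq_addr r _)) ?scaler0 //; apply: IH.
  rewrite -iterD; apply: iter_eq0_leq fd.
  by rewrite -addn1 leq_add2l subn_gt0.
- by move=> x y; rewrite iter_linearD.
- exact: iter_linear0.
Qed.

Lemma gbv_nilpotent i f : gbv f -> exists n, iter n (lo i) f = 0.
Proof.
elim=> {f} [|a f g _ [m hm] _ [n hn]|j f _ [n hn]].
- by have [n en] := dom i; exists n.+1; exact: lowering_vacuum_nilpotent.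
- exists (maxn m n); rewrite iter_linear.
  rewrite (iter_eq0_leq (leq_maxl m n) hm) (iter_eq0_leq (leq_maxr m n) hn).
  by rewrite scaler0 addr0.
- exact: lowering_nilpotent_step hn.
Qed.

Lemma irr_F_nilpotent i : locally_nilpotent (uqF V i).
Proof.
move=> v; have [n hn] := gbv_nilpotent i (irr_generated (v : L)).
exists n; apply: val_inj; rewrite -[RHS]hn.
exact: (@val_iter _ _ _ _ _ lam (uqF V i) (lo i)).
Qed.

Lemma irr_Oint : category_Oint V.
Proof.
split; [exact: irr_weight_module|exact: irr_E_nilpotent|exact: irr_F_nilpotent
  |exact: irr_Uplus_finite].
Qed.

Lemma irr_highest_vector : exists2 v : V, v != 0 & weight_vector lam v.
Proof.
pose v : V := irr (gbv_vacuum t lam); exists v.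
  apply/eqP => /(congr1 (fun y : L => val y [::])).
  by move/eqP; rewrite -[val _ _]/(1 : k) oner_eq0.
apply/irr_weight_vectorP => // w; rewrite -[val _ _]/(vacuum k w) /vacuum.
by case: w => //= i w; rewrite eqxx.
Qed.

End IrreducibleIntegrable.

(** * Dominant weights separate the Weyl group *)

Section DominantWeights.
Variables (R : realType) (I : finType) (D : root_datum R I).

Local Notation h := (rd_h D).
Local Notation h' := 'Hom(h, R[i]^o).
Local Notation coroot := (rd_coroot D).
Local Notation P := (@rd_lattice _ _ D).
Local Notation C := R[i].

Lemma functional_separation (x : h) : (forall l : h', l x = 0) -> x = 0.
Proof.
move=> lx; rewrite (coord_vbasis (memvf x)) big1 // => i _.
pose f : h -> C^o := coord (vbasis {:h}) i.
have f_linear : linear f by move=> a u v; rewrite /f linearP.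
pose f_lin := GRing.isLinear.Build _ _ _ _ f f_linear.
pose g : {linear h -> C^o} := HB.pack f f_lin.
by have := lx (linfun g); rewrite lfunE -[g x]/(f x) /f => ->; rewrite scale0r.
Qed.

Lemma common_denominator n (X : 'I_n -> rat) :
  exists2 N : nat, (0 < N)%N & exists z : 'I_n -> int, forall i, N%:R * X i = (z i)%:~R.
Proof.
pose N := (\prod_i `|denq (X i)|)%N.
have N0 : (0 < N)%N by apply: prodn_gt0 => i; rewrite absz_gt0 denq_neq0.
exists N => //; exists (fun i => (\prod_(j | j != i) `|denq (X j)|)%N%:Z * numq (X i)) => i.
rewrite /N (bigD1 i) //= natrM intrM [X in X * _ = _]mulrC -mulrA; congr (_ * _).
rewrite numqE mulrC; congr (_ * _).
by rewrite -[_%:R]/(`|denq (X i)|%N%:~R) gez0_abs // denq_ge0.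
Qed.

(** The pairings of a basis of [P] with the coroots form an integer matrix whose
    rows, indexed by the coroots, are independent over the complex numbers, hence
    over the rational numbers. So the system has a rational solution, and
    clearing denominators gives an element of [P]. *)
Lemma regular_dominant_weight : exists2 r : h', P r &
  exists2 N : nat, (0 < N)%N & forall i, r (coroot i) = N%:R.
Proof.
have [e be Pe] := lattice_basis D.
pose Z i j : int := sval (cid (rd_lattice_int j (Pe i))).
have ZE i j : tnth e i (coroot j) = (Z i j)%:~R by rewrite /Z; case: cid.
pose A : 'M[rat]_(#|I|, \dim {:h'}) := \matrix_(j, i) (Z i (enum_val j))%:~R.
have frA : row_free A.
  rewrite -(row_free_map (ratr : {rmorphism rat -> C})) -kermx_eq0.
  apply/rowV0P => v /sub_kermxP vA.
  pose x := \sum_(j < #|I|) v 0 j *: coroot (enum_val j).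
  have x0 : x = 0.
    apply: functional_separation => l; rewrite (coord_basis be (memvf l)) sum_lfunE big1 // => i _.
    rewrite scale_lfunE -tnth_nth linear_sum /=.
    have -> : \sum_(j < #|I|) tnth e i (v 0 j *: coroot (enum_val j)) = (v *m map_mx ratr A) 0 i.
      rewrite mxE; apply: eq_bigr => j _; rewrite linearZ /= ZE !mxE.
      by rewrite ratr_int.
    by rewrite vA mxE; exact: mulr0.
  have /freeP fr := rd_coroot_free D.
  apply/rowP => j; rewrite mxE; apply: (fr (v 0)).
  rewrite -[RHS]x0; apply: eq_bigr => o _; congr (_ *: _).
  by rewrite (nth_map (enum_val o)) -?cardE // -enum_val_nth.
have [B AB] := row_freeP frA.
pose X := B *m (const_mx 1 : 'cV[rat]_#|I|).
have AX j : \sum_i A j i * X i 0 = 1.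
  have : (A *m X) j 0 = 1 by rewrite mulmxA AB mul1mx mxE.
  by rewrite mxE.
have [N N0 [z zE]] := common_denominator (fun i => X i 0).
exists (\sum_i tnth e i *~ z i); first by apply: lattice_sum => i; exact: latticeMz.
exists N => // j; rewrite sum_lfunE.
have eN : \sum_i Z i j * z i = N%:Z.
  apply: (@intr_inj rat); rewrite rmorph_sum /=.
  transitivity (\sum_i N%:R * (A (enum_rank j) i * X i 0)); last first.
    by rewrite -mulr_sumr AX mulr1.
  by apply: eq_bigr => i _; rewrite mxE enum_rankK mulrCA zE intrM.
rewrite -[N%:R]/(N%:Z%:~R) -eN rmorph_sum; apply: eq_bigr => i _ /=.
by rewrite -scaler_int scale_lfunE ZE intrM mulrC.
Qed.

(** Every element of [P] becomes dominant after adding a multiple of a regular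
    dominant weight, so it is fixed as well, and [P] spans. *)
Lemma weyl_eq1 (w : weyl D) :
  (forall l, P l -> (forall i, exists n : nat, l (coroot i) = n%:R) -> act w l = l) -> w = 1%g.
Proof.
move=> fixd; have [r Pr [N N0 rN]] := regular_dominant_weight.
have fixP m : P m -> act w m = m.
  move=> Pm; pose z i : int := sval (cid (rd_lattice_int i Pm)).
  have zE i : m (coroot i) = (z i)%:~R by rewrite /z; case: cid.
  pose M := (\sum_i `|z i|)%N.
  have Mr : act w (r *+ M) = r *+ M.
    apply: fixd => [|i]; first exact: latticeMn.
    by exists (N * M)%N; rewrite -scaler_nat scale_lfunE rN natrM; exact: mulrC.
  apply: (addIr (r *+ M)); rewrite -{1}Mr -linearD; apply: fixd.
    by apply: latticeD => //; apply: latticeMn.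
  move=> i; have zM : (`|z i| <= N * M)%N.
    apply: leq_trans (leq_pmull _ N0); rewrite /M (bigD1 i) //=; exact: leq_addr.
  exists (absz (z i + (N * M)%N%:Z)).
  rewrite add_lfunE -scaler_nat scale_lfunE rN zE.
  have -> : ((absz (z i + (N * M)%N%:Z))%:R : C) = (z i + (N * M)%N%:Z)%:~R.
    by rewrite -[_%:R]/(_%:Z%:~R); congr (_%:~R); lia.
  by rewrite intrD; congr (_ + _); rewrite -[RHS]/((N * M)%N%:R) natrM; exact: mulrC.
apply: act_inj => l; rewrite act1.
have [e be Pe] := lattice_basis D.
rewrite (coord_basis be (memvf l)) linear_sum; apply: eq_bigr => i _.
by rewrite linearZ /= -tnth_nth fixP.
Qed.
End DominantWeights.

(** On the highest weight module of highest weight [l], the highest weight vector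
    is fixed by [x] and is sent by [x] to a vector of weight [psi x l]. *)
Lemma kernel_to_weyl (R : realType) (I : finType) (D : root_datum R I) (k : fieldType) (t : k)
    (psi : {multiplicative cactus D -> weyl D}) x :
  t != 0 -> (forall n, (0 < n)%N -> t ^+ n != 1) ->
  (forall J, psi (tau J) = longest D (val J)) -> cactus_kernel D t x -> psi x = 1%g.
Proof.
move=> t0 tn psit kx; apply: weyl_eq1 => l Pl dom.
have [rho act_rho rhox] := kx _ (irr_Oint t0 tn Pl dom).
have [v v0 wv] := irr_highest_vector t0 tn Pl.
apply: (weight_vector_unique t0 tn (lattice_act _ Pl) Pl v0 _ wv).
have := action_weight t0 tn (irr_Oint t0 tn Pl dom) act_rho psit x wv.
by rewrite rhox.
Qed.

Lemma ratr_0_1_N1 (k : fieldType) : [/\ ratr 0 = 0 :> k, ratr 1 = 1 :> k & ratr (-1) = -1 :> k].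
Proof. by split; rewrite /ratr ?mul0r ?divr1 //= -?[numq _]/(-1) ?mulrN1z ?divr1. Qed.

Lemma transcendental_nroot (k : fieldType) (t : k) :
  ~ algebraicOver (ratr : rat -> k) t -> t != 0 /\ forall n, (0 < n)%N -> t ^+ n != 1.
Proof.
have [r0 r1 rN1] := ratr_0_1_N1 k.
move=> trans; split.
  apply/eqP => t0; apply: trans; exists 'X; first by rewrite polyX_eq0.
  suff -> : map_poly (ratr : rat -> k) 'X = 'X by rewrite t0 rootX.
  apply/polyP => i; rewrite coef_map_id0 // !coefX.
  by case: (i == 1%N).
move=> n n0; apply/eqP => tn; apply: trans; exists ('X^n - 1).
  by rewrite -size_poly_eq0 size_XnsubC.
suff -> : map_poly (ratr : rat -> k) ('X^n - 1) = 'X^n - 1.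
  by rewrite /root !hornerE tn subrr.
apply/polyP => i; rewrite coef_map_id0 // !coefB !coefXn !coef1.
case: eqP => [->|_]; first by rewrite eqn0Ngt n0 !subr0.
by case: (i == 0%N); rewrite /= ?subrr ?sub0r.
Qed.

Theorem corollary1p9 (R : realType) (I : finType) (D : root_datum R I)
    (k : fieldType) (t : k) (char_k : [pchar k] =i pred0)
    (t_transcendental : ~ algebraicOver (ratr : rat -> k) t) :
  let G := quotient_group (cactus_kernel D t) in
  let sigma (J : finite_subset D) : G := quotient_proj (cactus_kernel D t) (tau J) in
  exists (phi : {multiplicative G -> weyl D})
         (psi : {multiplicative cactus D -> weyl D}),
  [/\ forall J, phi (sigma J) = longest D (val J),
      forall phi' : {multiplicative G -> weyl D},
        (forall J, phi' (sigma J) = longest D (val J)) -> phi' =1 phi,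
      forall w, exists x, phi x = w,
      (forall J, psi (tau J) = longest D (val J)) /\ (forall w, exists x, psi x = w) &
      forall x, psi x = phi (quotient_proj (cactus_kernel D t) x)].
Proof.
move=> G sigma; have [t0 tn] := transcendental_nroot t_transcendental.
have [psi psit] := cactus_to_weyl D.
have psi_surj w : exists x, psi x = w.
  have [u <-] := weyl_word w; elim: u => [|i u [x ex]].
    by exists 1%g; rewrite multiplicative1 wp_nil.
  exists (tau (exist (finite_type D) [set i] (finite_type1 D i)) * x)%g.
  by rewrite gmulfM ex psit wp_cons longest1.
have [phi phiE] := quotient_extend (fun x => kernel_to_weyl t0 tn psit (x := x)).
exists phi, psi; split=> //.
- by move=> J; rewrite phiE psit.
- move=> phi' phi't a; rewrite -(quotient_reprK a).
  elim/presented_ind: (repr a) => [|J|J|x y hx hy].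
  + by rewrite [quotient_proj _ _]multiplicative1 !multiplicative1.
  + by rewrite [LHS]phi't phiE psit.
  + by rewrite multiplicativeV !multiplicativeV [X in (X^-1)%g]phi't phiE psit.
  + by rewrite !gmulfM hx hy.
- by move=> w; have [x <-] := psi_surj w; exists (quotient_proj (cactus_kernel D t) x).
Qed.
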